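(* Let $\mathcal{H}$ be generated by an exponential decay kernel, $\mu_i\asymp\exp(-\gamma i^p)$ with $\gamma>0$, $p\ge1$. Suppose that Assumption A2 holds for $\lambda\asymp\lambda^\dagger:=(\log n)^{1/p}n^{-1}$ and $c_1,c_2\in(0,\infty]$. Then $$\|\widehat f_R-f_0\|_n^2=\mathcal{O}_P\big(n^{-1}(\log n)^{1/p}\big).$$
   Context: Model: $y_i=f_0(x_i)+\epsilon_i$, $i=1,\dots,n$, where $x_1,\dots,x_n$ are i.i.d. from a distribution $P_X$ on $\mathcal{X}\subseteq\mathbb{R}^d$ ($d\ge1$ fixed), $\epsilon_i$ are i.i.d. $N(0,1)$ and independent of $(x_1,\dots,x_n)$ and $S$, and $f_0\in\mathcal{H}$ is the true (fixed) regression function. Kernel: $\mathcal{H}\subset L^2(P_X)$ is an RKHS with inner product $\langle\cdot,\cdot\rangle_{\mathcal{H}}$ and reproducing kernel $K(x,x')=\sum_{i=1}^\infty\mu_i\phi_i(x)\phi_i(x')$, with ordered eigenvalues $\mu_1\ge\mu_2\ge\cdots\ge0$, where $\{\phi_i\}$ is a basis of $L^2(P_X)$ with $\langle\phi_i,\phi_j\rangle_{L^2(P_X)}=\delta_{ij}$ and $\langle\phi_i,\phi_j\rangle_{\mathcal{H}}=\delta_{ij}/\mu_i$. Assumption A1 (standing): $\sup_{i\ge1}\|\phi_i\|_{\sup}<\infty$ and $\sup_{k\ge1}\frac{\sum_{i=k+1}^\infty\mu_i}{k\mu_k}<\infty$. Estimator: $\boldsymbol{K}=[n^{-1}K(x_i,x_j)]_{1\le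 i,j\le n}$, $\boldsymbol{y}=(y_1,\dots,y_n)^\top$; for an $s\times n$ real random matrix $S$, $\widehat\beta=\frac1n(S\boldsymbol{K}^2S^\top+\lambda S\boldsymbol{K}S^\top)^{-1}S\boldsymbol{K}\boldsymbol{y}$, $\widehat f_R(\cdot)=\sum_{i=1}^n(S^\top\widehat\beta)_iK(\cdot,x_i)$. $\|g\|_n^2=\frac1n\sum_{i=1}^ng(x_i)^2$. Let $\boldsymbol{K}=UDU^\top$, $UU^\top=I_n$, $D=\mathrm{diag}(\widehat\mu_1,\dots,\widehat\mu_n)$, $\widehat\mu_1\ge\cdots\ge\widehat\mu_n\ge0$. Let $\widehat s_\lambda=\min\{i:\widehat\mu_i\le\lambda\}-1$ and $s_\lambda=\min\{i:\mu_i\le\lambda\}-1$. Write $U=(U_1,U_2)$ with $U_1$ the first $\widehat s_\lambda$ columns, and $D_2=\mathrm{diag}(\widehat\mu_{\widehat s_\lambda+1},\dots,\widehat\mu_n)$. $S$ is $\boldsymbol{K}$-satisfiable if there is a constant $c>0$ with $\|(SU_1)^\top SU_1-I_{\widehat s_\lambda}\|_{\mathrm{op}}\le1/2$ and $\|SU_2D_2^{1/2}\|_{\mathrm{op}}\le c\lambda^{1/2}$. An event $\mathcal{E}$ is of $(a,b)$-type, $a,b\in(0,\infty]$, if $P(P(\mathcal{E}\mid x_1,\dots,x_n)\ge1-e^{-a})\ge1-e^{-b}$. Assumption A2: (a) $s\ge ds_\lambda$ for a sufficiently large constant $d>0$; (b) there exist $c_1,c_2\in(0,\infty]$ such that the event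 ''$S$ is $\boldsymbol{K}$-satisfiable'' is of $(c_1s,c_2s_\lambda)$-type. *)

(* Defs.v *)
From HB Require Import structures.
From mathcomp Require Import all_boot all_order all_algebra.
From mathcomp Require Import all_classical all_reals all_analysis.

Set Implicit Arguments.
Unset Strict Implicit.
Unset Printing Implicit Defensive.

Import Order.TTheory GRing.Theory Num.Theory.
Import numFieldNormedType.Exports.

Local Open Scope classical_set_scope.
Local Open Scope ring_scope.

(* The covariate space X, a subset of R^d, with the trace of the Borel
   sigma-algebra of R^d. The point x0 is there because measurable types are
   pointed; a space that carries a probability is nonempty. *)
Section covariate_space.
Context {R : realType} {d : nat} {X : set (d.-tuple R)}.

Definition covariate (x0 : X) : Type := set_type X.

Context (x0 : X).

HB.instance Definition _ := Choice.copy (covariate x0) (set_type X).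
HB.instance Definition _ := isPointed.Build (covariate x0) x0.

Definition covariate_val : covariate x0 -> d.-tuple R := set_val.

HB.instance Definition _ := Measurable.copy (covariate x0)
  (g_sigma_algebra_preimageType covariate_val).

End covariate_space.

(* A Hilbert space H of real functions on T, with inner product ip and
   reproducing kernel K. The values of ip outside H are irrelevant. *)
Definition fnorm (R : realType) (T : Type) (ip : (T -> R) -> (T -> R) -> R)
    (f : T -> R) : R :=
  Num.sqrt (ip f f).

Record is_rkhs (R : realType) (T : Type) (H : set (T -> R))
    (ip : (T -> R) -> (T -> R) -> R) (K : T -> T -> R) : Prop := IsRKHS {
  rkhs_zero : H (fun=> 0) ;
  rkhs_lin : forall a f g, H f -> H g -> H (fun t => a * f t + g t) ;
  rkhs_ip_sym : forall f g, H f -> H g -> ip f g = ip g f ;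
  rkhs_ip_lin : forall a f g h, H f -> H g -> H h ->
    ip (fun t => a * f t + g t) h = a * ip f h + ip g h ;
  rkhs_ip_ge0 : forall f, H f -> 0 <= ip f f ;
  rkhs_ip_eq0 : forall f, H f -> ip f f = 0 -> f = (fun=> 0) ;
  rkhs_complete : forall u : nat -> T -> R, (forall m, H (u m)) ->
    (forall e : R, 0 < e -> exists N, forall m n, (N <= m)%N -> (N <= n)%N ->
       fnorm ip (u m \- u n) < e) ->
    exists f, H f /\ ((fnorm ip (u m \- f)) @[m --> \oo] --> 0) ;
  rkhs_kernel : forall x, H (K x) ;
  rkhs_reproducing : forall f x, H f -> ip f (K x) = f x
}.

(* Eigenvalues and eigenfunctions are indexed from 0: mu i and phi i are the
   (i+1)-st ones. *)
Record is_eigensystem d (T : measurableType d) (R : realType)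
    (PX : probability T R) (H : set (T -> R))
    (ip : (T -> R) -> (T -> R) -> R) (K : T -> T -> R)
    (mu : nat -> R) (phi : nat -> T -> R) : Prop := IsEigensystem {
  eig_ge0 : forall i, 0 <= mu i ;
  eig_decr : forall i j, (i <= j)%N -> mu j <= mu i ;
  eig_L2 : forall i, phi i \in Lfun PX 2%:E ;
  eig_orthonormal : forall i j,
    (\int[PX]_t (phi i t * phi j t)%:E)%E = (i == j)%:R%:E ;
  eig_basis : forall g : T -> R, g \in Lfun PX 2%:E ->
    exists a : nat -> R,
      Lnorm PX 2%:E (fun t => (g t - \sum_(i < N) a i * phi i t)%:E)
        @[N --> \oo] --> 0%E ;
  eig_H : forall i, H (phi i) ;
  eig_ip : forall i j, ip (phi i) (phi j) = (i == j)%:R / mu i ;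
  eig_kernel : forall x x',
    (\sum_(i < N) mu i * phi i x * phi i x') @[N --> \oo] --> K x x'
}.

Definition assumption_A1 (R : realType) (T : Type)
    (mu : nat -> R) (phi : nat -> T -> R) : Prop :=
  (exists C : R, forall i t, `|phi i t| <= C) /\
  (exists C : R, forall k,
     (\sum_(k.+1 <= i <oo) (mu i)%:E <= (C * (k.+1%:R * mu k))%:E)%E).

Section sketched_regression.
Context {R : realType} {T : Type}.

Definition kernel_mx (K : T -> T -> R) n (x : 'I_n -> T) : 'M[R]_n :=
  \matrix_(i, j) (n%:R^-1 * K (x i) (x j)).

Definition response n (f0 : T -> R) (x : 'I_n -> T) (eps : 'I_n -> R) :
    'cV[R]_n :=
  \col_i (f0 (x i) + eps i).

(* pinvmx is invmx on invertible matrices (pinvmxE) and a generalized inverse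
   on singular ones. S K^2 S^T + lam S K S^T can be singular: nothing prevents S
   from having more than n rows, or repeated rows. invmx would return a singular
   matrix unchanged. *)
Definition beta_hat n s (Km : 'M[R]_n) (lam : R) (S : 'M[R]_(s, n))
    (y : 'cV[R]_n) : 'cV[R]_s :=
  n%:R^-1 *:
    (pinvmx (S *m (Km *m Km) *m S^T + lam *: (S *m Km *m S^T))
       *m (S *m Km *m y)).

Definition f_hat n s (K : T -> T -> R) (x : 'I_n -> T) (lam : R)
    (S : 'M[R]_(s, n)) (y : 'cV[R]_n) : T -> R :=
  fun t => \sum_(i < n)
    (S^T *m beta_hat (kernel_mx K x) lam S y) i 0 * K t (x i).

Definition emp_norm_sq n (x : 'I_n -> T) (g : T -> R) : R :=
  n%:R^-1 * \sum_(i < n) g (x i) ^+ 2.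

End sketched_regression.

Section satisfiability.
Context {R : realType}.

Definition l2norm n (v : 'cV[R]_n) : R := Num.sqrt (\sum_(i < n) v i 0 ^+ 2).

Definition opnorm m n (A : 'M[R]_(m, n)) : R :=
  sup [set l2norm (A *m v) | v in [set v : 'cV[R]_n | l2norm v <= 1]].

Definition spectral_decomposition n (Km U : 'M[R]_n) (mh : 'rV[R]_n) : Prop :=
  [/\ Km = U *m diag_mx mh *m U^T, U *m U^T = 1%:M,
      forall i j : 'I_n, (i <= j)%N -> mh 0 j <= mh 0 i
    & forall i, 0 <= mh 0 i].

(* min {i >= 1 : mu_i <= lam} - 1 is the least 0-based index at which the
   sequence is at most lam. *)
Definition s_pop (mu : nat -> R) (lam : R) : nat :=
  xget 0%N [set k | mu k <= lam /\ forall j, (j < k)%N -> lam < mu j].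

(* This is n when all n empirical eigenvalues exceed lam. *)
Definition s_emp n (mh : 'rV[R]_n) (lam : R) : nat :=
  find (fun i => mh 0 i <= lam) (enum 'I_n).

Lemma s_emp_le n (mh : 'rV[R]_n) lam : (s_emp mh lam <= n)%N.
Proof. by rewrite -[leqRHS]size_enum_ord find_size. Qed.

Definition head_idx n (mh : 'rV[R]_n) lam (j : 'I_(s_emp mh lam)) : 'I_n :=
  widen_ord (s_emp_le mh lam) j.

Definition tail_idx n (mh : 'rV[R]_n) lam (j : 'I_(n - s_emp mh lam)) : 'I_n :=
  cast_ord (subnKC (s_emp_le mh lam)) (rshift (s_emp mh lam) j).

(* The two conditions do not depend on the choice of the decomposition: the
   cut between the two blocks never splits an eigenspace. *)
Definition K_satisfiable n s (c lam : R) (Km : 'M[R]_n) (S : 'M[R]_(s, n)) :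
    Prop :=
  exists (U : 'M[R]_n) (mh : 'rV[R]_n),
    [/\ spectral_decomposition Km U mh,
        let U1 := colsub (head_idx (mh := mh) (lam := lam)) U in
        opnorm ((S *m U1)^T *m (S *m U1) - 1%:M) <= 2^-1
      & let U2 := colsub (tail_idx (mh := mh) (lam := lam)) U in
        let sqrtD2 := diag_mx (\row_j Num.sqrt (mh 0 (@tail_idx n mh lam j))) in
        opnorm (S *m U2 *m sqrtD2) <= c * Num.sqrt lam].

End satisfiability.

Section probability_notions.
Context d (Omega : measurableType d) (R : realType) (P : probability Omega R).

(* Taking some A i to be the full set gives the product rule for subfamilies. *)
Definition mutually_independent d' (T : measurableType d') n
    (X : 'I_n -> Omega -> T) : Prop :=
  forall A : 'I_n -> set T, (forall i, measurable (A i)) ->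
    P (\bigcap_(i in [set: 'I_n]) (X i @^-1` A i)) =
    (\prod_(i < n) P (X i @^-1` A i))%E.

Definition independent_sigma (G1 G2 : set (set Omega)) : Prop :=
  forall A B, G1 A -> G2 B -> P (A `&` B) = (P A * P B)%E.

Definition sigma_mx m n (S : Omega -> 'M[R]_(m, n)) : set (set Omega) :=
  <<s \bigcup_(ij in [set: 'I_m * 'I_n])
        preimage_set_system setT (fun w => S w ij.1 ij.2) measurable >>.

(* g is a version of the conditional probability of E given the
   sub-sigma-algebra G. *)
Definition is_cond_prob (G : set (set Omega)) (E : set Omega)
    (g : Omega -> R) : Prop :=
  [/\ forall B : set R, measurable B -> G (g @^-1` B),
      P.-integrable setT (EFin \o g)
    & forall A, G A -> (\int[P]_(w in A) (g w)%:E)%E = P (E `&` A)].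

(* Versions agree almost surely, so it does not matter which one g is. The
   product of +oo and 0 is 0. *)
Definition ab_type (G : set (set Omega)) (a b : \bar R) (E : set Omega) :
    Prop :=
  measurable E /\
  exists g : Omega -> R, is_cond_prob G E g /\
    (1 - expeR (- b) <= P [set w | 1 - expeR (- a) <= (g w)%:E])%E.

(* Z n = O_P(r n), with outer probability: B can be taken to be the event
   itself whenever that is measurable. P carries no information on sets that
   are not measurable. *)
Definition bigO_P (Z : nat -> Omega -> R) (r : nat -> R) : Prop :=
  forall e : R, 0 < e -> exists M : R, 0 < M /\
    \forall n \near \oo, exists B : set Omega,
      [/\ measurable B, [set w | M * r n < `|Z n w|] `<=` B
        & (P B <= e%:E)%E].

(* For each sample size n, the design x n, the noise eps n and the s n by n
   sketching matrix S n; S n may depend on the design. *)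
Record sketched_model d' (T : measurableType d') (PX : probability T R)
    (x : forall n, 'I_n -> {RV P >-> T})
    (eps : forall n, 'I_n -> {RV P >-> R})
    (s : nat -> nat) (S : forall n, Omega -> 'M[R]_(s n, n)) : Prop :=
  SketchedModel {
  model_x_law : forall n (i : 'I_n) A, measurable A ->
    distribution P (x n i) A = PX A ;
  model_x_indep : forall n,
    mutually_independent (fun i => x n i : Omega -> T) ;
  model_eps_law : forall n (i : 'I_n) A, measurable A ->
    distribution P (eps n i) A = normal_prob 0 1 A ;
  model_eps_indep : forall n,
    mutually_independent (fun i => eps n i : Omega -> R) ;
  model_S_meas : forall n i j,
    measurable_fun setT (fun w => S n w i j : R) ;
  model_indep : forall n, independent_sigma
    (g_sigma_preimage (fun i => eps n i : Omega -> R))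
    <<s g_sigma_preimage (fun i => x n i : Omega -> T) `|` sigma_mx (S n) >>
}.

(* D, c, c1 and c2 do not depend on n. *)
Definition assumption_A2 d' (T : measurableType d')
    (K : T -> T -> R) (mu : nat -> R)
    (x : forall n, 'I_n -> {RV P >-> T})
    (s : nat -> nat) (S : forall n, Omega -> 'M[R]_(s n, n))
    (lam : nat -> R) (D c : R) (c1 c2 : \bar R) : Prop :=
  (\forall n \near \oo, D * (s_pop mu (lam n))%:R <= (s n)%:R) /\
  (\forall n \near \oo,
     ab_type (g_sigma_preimage (fun i => x n i : Omega -> T))
       (c1 * (s n)%:R%:E)%E (c2 * (s_pop mu (lam n))%:R%:E)%E
       [set w | K_satisfiable c (lam n)
                  (kernel_mx K (fun i => x n i w)) (S n w)]).

End probability_notions.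

Definition lambda_dagger (R : realType) (p : R) (n : nat) : R :=
  ln n%:R `^ p^-1 / n%:R.

(* Main.v *)
Require Import Defs.
From HB Require Import structures.
From mathcomp Require Import all_boot all_order all_algebra.
From mathcomp Require Import all_classical all_reals all_analysis.
From mathcomp Require Import measurable_realfun ring lra.

(** The error at the design points is bounded by a deterministic bias term and a
    noise term, and neither bound refers to the sketch [S] except through the
    event that [S] is satisfiable.

    Write [Km] for the kernel matrix, [z] for the values of [f0] at the design
    points and [N = Km (Km + lam)^-1] for the smoother of exact kernel ridge
    regression. The sketched estimator minimizes a penalized least squares
    criterion over the range of [S^T] ([sketched_normal_eq]). Two consequences
    of this carry the proof.

    Bias. The fit to [z] is at least as good as any sketched competitor
    ([sketched_bias]). If [S] is satisfiable there is a competitor that agrees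
    with [z] on the eigenvectors of [Km] with eigenvalue above [lam] and stays
    small on the others, so that the squared bias is a multiple of
    [lam |f0|_H^2] ([bias_satisfiable]). The smoothness of [f0] enters by
    duality, [(a . z)^2 <= n |f0|_H^2 (a . Km a)] ([kernel_mx_dual]).

    Noise. The coefficients of the fit to a noise vector [e] are a projection of
    those of the exact ridge fit, in the inner product of the penalized
    criterion, and the squared norm of the fit is at most [e . N e]
    ([sketched_variance]). This bound depends on the design only,
    which is independent of the noise, so its mean is a multiple of the mean of
    [\tr N] ([integral_quadratic_form]). Along the Mercer expansion the
    [i]-th eigenfunction contributes at most [min (1, C^2 mu_i / lam)] to
    [\tr N], whatever the design ([trace_ridge_le]); for exponentially decaying
    eigenvalues and [lam] of order [(ln n)^(1/p) / n] the sum is of order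
    [(ln n)^(1/p)] ([trace_ridge_log]). Markov's inequality turns this into a
    bound in probability.

    Finally [lam] tends to zero, so [s_pop] and [s] tend to infinity and the
    event that [S] is satisfiable has probability tending to one
    ([ab_type_probability]). *)

Set Implicit Arguments.
Unset Strict Implicit.
Unset Printing Implicit Defensive.

Import Order.TTheory GRing.Theory Num.Theory.
Import numFieldNormedType.Exports.

Local Open Scope classical_set_scope.
Local Open Scope ring_scope.

(** * Dot product and positive semidefinite matrices *)

Section dot_product.
Context {R : realFieldType}.

Definition dot n (u v : 'cV[R]_n) : R := \sum_i u i 0 * v i 0.

Lemma dotC n (u v : 'cV[R]_n) : dot u v = dot v u.
Proof. by apply: eq_bigr => i _; rewrite mulrC. Qed.

Lemma dotDl n (u v w : 'cV[R]_n) : dot (u + v) w = dot u w + dot v w.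
Proof. by rewrite /dot -big_split; apply: eq_bigr => i _; rewrite mxE mulrDl. Qed.

Lemma dotZl n a (u w : 'cV[R]_n) : dot (a *: u) w = a * dot u w.
Proof. by rewrite /dot mulr_sumr; apply: eq_bigr => i _; rewrite mxE mulrA. Qed.

Lemma dotNl n (u w : 'cV[R]_n) : dot (- u) w = - dot u w.
Proof. by rewrite -scaleN1r dotZl mulN1r. Qed.

Lemma dotDr n (u v w : 'cV[R]_n) : dot w (u + v) = dot w u + dot w v.
Proof. by rewrite dotC dotDl !(dotC w). Qed.

Lemma dotZr n a (u w : 'cV[R]_n) : dot w (a *: u) = a * dot w u.
Proof. by rewrite dotC dotZl (dotC w). Qed.

Lemma dotNr n (u w : 'cV[R]_n) : dot w (- u) = - dot w u.
Proof. by rewrite dotC dotNl (dotC w). Qed.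

Lemma dot0l n (w : 'cV[R]_n) : dot 0 w = 0.
Proof. by rewrite /dot big1// => i _; rewrite mxE mul0r. Qed.

Definition dotE := (dotDl, dotDr, dotNl, dotNr, dotZl, dotZr).

Lemma dot_mxE n (u v : 'cV[R]_n) : dot u v = (u^T *m v) 0 0.
Proof. by rewrite mxE; apply: eq_bigr => i _; rewrite mxE. Qed.

Lemma dot_mull m n (A : 'M[R]_(m, n)) u v : dot (A *m u) v = dot u (A^T *m v).
Proof. by rewrite !dot_mxE trmx_mul mulmxA. Qed.

Lemma dot_ge0 n (u : 'cV[R]_n) : 0 <= dot u u.
Proof. by apply: sumr_ge0 => i _; rewrite -expr2 sqr_ge0. Qed.

Lemma dot_eq0 n (u : 'cV[R]_n) : dot u u = 0 -> u = 0.
Proof.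
move=> /eqP; rewrite psumr_eq0; last by move=> i _; rewrite -expr2 sqr_ge0.
move=> /allP u0; apply/colP => i; rewrite mxE.
by have := u0 i (mem_index_enum _); rewrite -expr2 sqrf_eq0 => /eqP.
Qed.

Lemma dot_sqr_le n (u v : 'cV[R]_n) : dot u v ^+ 2 <= dot u u * dot v v.
Proof.
have [v0|v0] := eqVneq (dot v v) 0.
  by rewrite (dot_eq0 v0) dotC !dot0l mulr0 expr0n.
have vp : 0 < dot v v by rewrite lt_neqAle eq_sym v0 dot_ge0.
have := dot_ge0 (dot v v *: u - dot u v *: v).
rewrite !dotE (dotC v u) => H.
have : 0 <= dot v v * (dot u u * dot v v - dot u v ^+ 2) by nra.
by rewrite pmulr_rge0// subr_ge0.
Qed.

Lemma dot_add_sqr_le n (u v : 'cV[R]_n) :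
  dot (u + v) (u + v) <= 2 * dot u u + 2 * dot v v.
Proof. by have := dot_ge0 (u - v); rewrite !dotE (dotC v u); lra. Qed.

Lemma dot_delta n (i : 'I_n) (u : 'cV[R]_n) : dot (delta_mx i 0) u = u i 0.
Proof.
rewrite /dot (bigD1 i)//= mxE !eqxx mul1r big1 ?addr0// => j ji.
by rewrite mxE (negbTE ji) mul0r.
Qed.

End dot_product.

Section positive_semidefinite.
Context {R : realFieldType}.

Definition psdmx n (A : 'M[R]_n) : Prop :=
  A^T = A /\ forall u, 0 <= dot u (A *m u).

Lemma psd_dotC n (A : 'M[R]_n) u v : psdmx A ->
  dot u (A *m v) = dot (A *m u) v.
Proof. by case=> sA _; rewrite dot_mull sA. Qed.

Lemma unitmx_ker0 n (A : 'M[R]_n) :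
  (forall u : 'cV_n, A *m u = 0 -> u = 0) -> A \in unitmx.
Proof.
move=> A0; rewrite -unitmx_tr -row_free_unit -kermx_eq0.
apply/eqP/trmx_inj; rewrite trmx0; apply/matrixP => i j.
have kA : A *m (kermx A^T)^T = 0.
  by apply: trmx_inj; rewrite trmx_mul trmxK mulmx_ker trmx0.
have /A0/colP/(_ i) : A *m col j (kermx A^T)^T = 0.
  by rewrite colE mulmxA kA mul0mx.
by rewrite !mxE.
Qed.

Lemma psd_shift_unit n (A : 'M[R]_n) lam : psdmx A -> 0 < lam ->
  A + lam%:M \in unitmx.
Proof.
move=> pA lam0; apply: unitmx_ker0 => u /(congr1 (dot u)).
rewrite mulmxDl mul_scalar_mx !dotE (dotC _ 0) dot0l => Au; apply: dot_eq0.
by have := pA.2 u; have := dot_ge0 u; nra.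
Qed.

End positive_semidefinite.

(** * Ridge smoother and sketched ridge regression *)

Section ridge.
Context {R : realFieldType} {n : nat}.
Variables (K : 'M[R]_n) (lam : R).
Hypotheses (psdK : psdmx K) (lam_gt0 : 0 < lam).

Definition resolvent : 'M[R]_n := invmx (K + lam%:M).

Definition ridge_smoother : 'M[R]_n := K *m resolvent.

Lemma resolvent_eq (y : 'cV[R]_n) :
  K *m (resolvent *m y) + lam *: (resolvent *m y) = y.
Proof.
rewrite -mul_scalar_mx -mulmxDl mulmxA mulmxV ?mul1mx//.
exact: psd_shift_unit.
Qed.

Lemma resolvent_dot (y : 'cV[R]_n) : 
  dot y (resolvent *m y) = dot (resolvent *m y) (K *m (resolvent *m y)) +
    lam * dot (resolvent *m y) (resolvent *m y).
Proof. by rewrite -{1}(resolvent_eq y) !dotE (dotC (K *m _)). Qed.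

Lemma resolvent_dot_le (y : 'cV[R]_n) :
  lam * dot y (resolvent *m y) <= dot y y.
Proof.
rewrite -{3 4}(resolvent_eq y) resolvent_dot; set u := resolvent *m y.
rewrite !dotE (dotC (K *m u) u).
have := psdK.2 u; have := dot_ge0 u; have := dot_ge0 (K *m u).
move: lam_gt0; nra.
Qed.

(** With [u = resolvent v] and [q = v . u = u . (K + lam) u], the hypothesis at
    [u] gives [t q^2 <= q]. *)
Lemma resolvent_dot_le1 (t : R) (v : 'cV[R]_n) :
  (forall u, t * dot v u ^+ 2 <= dot u (K *m u)) ->
  t * dot v (resolvent *m v) <= 1.
Proof.
move=> vK; have := vK (resolvent *m v); have := resolvent_dot v.
set u := resolvent *m v; set q := dot v u; have := mulr_ge0 (ltW lam_gt0) (dot_ge0 u).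
move: (psdK.2 u) => u0 u1 qE tq; have q0 : 0 <= q by lra.
have : t * q ^+ 2 <= q by lra.
move: q0; rewrite le_eqVlt => /orP[/eqP <-|q0]; first by rewrite mulr0.
by rewrite expr2 mulrA -{3}[q]mul1r ler_pM2r.
Qed.

Lemma ridge_smoother_dot_le (y : 'cV[R]_n) :
  dot (ridge_smoother *m y) (ridge_smoother *m y) <= dot y y.
Proof.
rewrite /ridge_smoother -mulmxA -{3 4}(resolvent_eq y).
set u := resolvent *m y; rewrite !dotE (dotC (K *m u) u).
have := psdK.2 u; have := dot_ge0 u; move: lam_gt0; nra.
Qed.

Lemma ridge_smoother_ge0 (y : 'cV[R]_n) : 0 <= dot y (ridge_smoother *m y).
Proof.
rewrite /ridge_smoother -mulmxA -{1}(resolvent_eq y); set u := resolvent *m y.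
rewrite !dotE; have := psdK.2 u; have := dot_ge0 (K *m u); move: lam_gt0; nra.
Qed.

Lemma ridge_smoother_trace_ge0 : 0 <= \tr ridge_smoother.
Proof.
apply: sumr_ge0 => i _; have := ridge_smoother_ge0 (delta_mx i 0).
by rewrite dot_delta -colE mxE.
Qed.

(** The uniform bound makes every entry integrable when the design is random. *)
Lemma ridge_smoother_entry_le1 i j : `|ridge_smoother i j| <= 1.
Proof.
have E : dot (delta_mx i 0) (ridge_smoother *m delta_mx j 0) = ridge_smoother i j.
  by rewrite dot_delta -colE mxE.
have dd k : dot (delta_mx k 0 : 'cV[R]_n) (delta_mx k 0) = 1.
  by rewrite dot_delta mxE !eqxx.
rewrite -(@ler_pXn2r _ 2)// ?nnegrE// expr1n real_normK ?num_real//.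
rewrite -E (le_trans (dot_sqr_le _ _))// dd mul1r -(dd j).
exact: ridge_smoother_dot_le.
Qed.

Context {s : nat}.
Variable S : 'M[R]_(s, n).

Definition sketched_gram : 'M[R]_s :=
  S *m (K *m K) *m S^T + lam *: (S *m K *m S^T).

(** With [y] the response, these are the coefficients of the sketched estimator
    on the kernel sections at the design points, times the sample size. *)
Definition sketched_coef (y : 'cV[R]_n) : 'cV[R]_n :=
  S^T *m (pinvmx sketched_gram *m (S *m K *m y)).

Lemma sketched_gram_tr : sketched_gram^T = sketched_gram.
Proof.
rewrite /sketched_gram linearD linearZ /= !trmx_mul !trmxK psdK.1.
by rewrite !mulmxA.
Qed.

(** The energy of [v] under the Gram matrix is [|K S^T v|^2] plus a nonnegative
    term, so a null vector of the Gram matrix is already killed by [K S^T]. *)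
Lemma sketched_gram_ker (v : 'cV[R]_s) : 
  sketched_gram *m v = 0 -> K *m (S^T *m v) = 0.
Proof.
move=> Av; apply: dot_eq0.
have := congr1 (dot v) Av; rewrite (dotC _ 0) dot0l /sketched_gram.
rewrite mulmxDl -scalemxAl -!mulmxA !dotE.
rewrite -{1 3}[S]trmxK -!dot_mull.
rewrite (psd_dotC _ _ psdK).
have := psdK.2 (S^T *m v); have := dot_ge0 (K *m (S^T *m v)).
move: lam_gt0; nra.
Qed.

(** The generalized inverse solves the normal equations even when the Gram
    matrix is singular: by [sketched_gram_ker] the columns of [S K] lie in the
    range of the Gram matrix, on which [pinvmx] is a right inverse. *)
Lemma sketched_normal_eq (y : 'cV[R]_n) :
  S *m (K *m (K *m sketched_coef y + lam *: sketched_coef y)) = S *m (K *m y).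
Proof.
have -> : S *m (K *m (K *m sketched_coef y + lam *: sketched_coef y)) =
   sketched_gram *m (pinvmx sketched_gram *m (S *m K *m y)).
  rewrite /sketched_coef /sketched_gram mulmxDl !mulmxDr -!scalemxAr.
  by rewrite -scalemxAl !mulmxA.
have : ((S *m K)^T <= sketched_gram)%MS.
  rewrite submxE; apply/eqP/matrixP => i j.
  have Ac : sketched_gram *m col j (cokermx sketched_gram) = 0.
    by rewrite colE mulmxA mulmx_coker mul0mx.
  rewrite trmx_mul psdK.1 [RHS]mxE.
  have := congr1 (fun u : 'cV_n => u i 0) (sketched_gram_ker Ac).
  by rewrite colE !mulmxA -colE [LHS]mxE [RHS]mxE.
move=> /submxP[Y YE].
have SKE : S *m K = sketched_gram *m Y^T.
  by apply: trmx_inj; rewrite YE [RHS]trmx_mul trmxK sketched_gram_tr.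
have := mulmxKpV (submx_refl sketched_gram); rewrite (mulmxA S) SKE.
by move: (pinvmx _) => p gpg; rewrite !mulmxA gpg.
Qed.

(** A sketched fit is never rougher than the exact ridge fit. In the inner
    product [<a, b> = (K a) . (K b) + lam (a . K b)] the normal equations say
    that the sketched coefficients [b] are the orthogonal projection of the exact
    ridge coefficients [u], hence [|K b|^2 <= <b, b> <= <u, u>], and [<u, u>] is
    the quadratic form of the ridge smoother at [y]. The right-hand side is free
    of the sketch, which may therefore depend on the design in any way. *)
Lemma sketched_variance (y : 'cV[R]_n) :
  dot (K *m sketched_coef y) (K *m sketched_coef y) <=
  dot y (ridge_smoother *m y).
Proof.
rewrite /ridge_smoother -mulmxA.
have e := resolvent_eq y; set u := resolvent *m y in e *.
have e1 : dot (sketched_coef y)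
    (K *m (K *m sketched_coef y + lam *: sketched_coef y)) =
    dot (sketched_coef y) (K *m y).
  by rewrite {1 4}/sketched_coef !(dot_mull S^T) trmxK sketched_normal_eq.
move: e1; set b := sketched_coef y; rewrite -e.
rewrite !mulmxDr -!scalemxAr !dotE !(psd_dotC b (K *m _) psdK) => e1.
have := psdK.2 (u - b); have := dot_ge0 (K *m u - K *m b).
have := psdK.2 b.
rewrite mulmxDr mulmxN !dotE (dotC (K *m u) (K *m b)) (dotC u (K *m u)).
have -> : dot u (K *m b) = dot b (K *m u) by rewrite (psd_dotC _ _ psdK) dotC.
rewrite (dotC (K *m u) u).
move=> b0 Ku0 /(mulr_ge0 (ltW lam_gt0)); have := mulr_ge0 (ltW lam_gt0) b0.
move: e1; lra.
Qed.

(** The sketched fit minimizes the penalized least squares criterion over the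
    range of [S^T]: the normal equations make the gradient orthogonal to every
    admissible direction [b - a]. *)
Lemma sketched_bias (z : 'cV[R]_n) (th : 'cV[R]_s) :
  let r := z - K *m sketched_coef z in let b := S^T *m th in
  dot r r <= dot (z - K *m b) (z - K *m b) + lam * dot b (K *m b).
Proof.
set a := sketched_coef z => /=; set r := z - K *m a; set b := S^T *m th.
have ortho : dot (b - a) (K *m (K *m a + lam *: a - z)) = 0.
  have -> : b - a = S^T *m
      (th - pinvmx sketched_gram *m (S *m K *m z)) by rewrite mulmxBr.
  rewrite dot_mull trmxK (mulmxBr K) mulmxBr sketched_normal_eq subrr.
  by rewrite dotC dot0l.
set h := b - a in ortho; have bE : b = a + h by rewrite addrC subrK.
have -> : z - K *m b = r - K *m h by rewrite bE mulmxDr opprD addrA.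
rewrite bE.
have E : K *m a + lam *: a - z = lam *: a - r.
  by rewrite /r opprB [LHS]addrAC [RHS]addrC.
move: ortho; rewrite E; clearbody h r; rewrite !(mulmxDr K) mulmxN -scalemxAr !dotE.
have -> : dot a (K *m h) = dot h (K *m a) by rewrite (psd_dotC _ _ psdK) dotC.
rewrite (psd_dotC h r psdK) (dotC r (K *m h)) => ortho.
have := dot_ge0 (K *m h); have := mulr_ge0 (ltW lam_gt0) (psdK.2 h).
have := mulr_ge0 (ltW lam_gt0) (psdK.2 a).
move: ortho; lra.
Qed.

End ridge.

(** * Bias on the event that the sketch is satisfiable *)

Section operator_norm.
Context {R : realType}.

Lemma le_of_sqr_le (x y : R) : 0 <= x -> 0 <= y -> x ^+ 2 <= y * x -> x <= y.
Proof.
by rewrite le_eqVlt => /orP[/eqP <-//|x0 _]; rewrite expr2 ler_pM2r.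
Qed.

Lemma ler_abs_of_sqr (x y : R) : 0 <= y -> x ^+ 2 <= y ^+ 2 -> - y <= x <= y.
Proof.
move=> y0; rewrite -ler_norml -[x ^+ 2]real_normK ?num_real//.
by rewrite ler_pXn2r ?nnegrE.
Qed.

Lemma l2normE n (v : 'cV[R]_n) : l2norm v = Num.sqrt (dot v v).
Proof. by congr Num.sqrt; apply: eq_bigr => i _; rewrite expr2. Qed.

Lemma l2norm_sqr n (v : 'cV[R]_n) : l2norm v ^+ 2 = dot v v.
Proof. by rewrite l2normE sqr_sqrtr ?dot_ge0. Qed.

Lemma dot_mulmx_le_frobenius m n (A : 'M[R]_(m, n)) (v : 'cV_n) :
  dot (A *m v) (A *m v) <= (\sum_i dot (row i A)^T (row i A)^T) * dot v v.
Proof.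
rewrite mulr_suml; apply: ler_sum => i _; rewrite -expr2.
have -> : (A *m v) i 0 = dot (row i A)^T v.
  by rewrite dot_mxE trmxK -row_mul [RHS]mxE.
exact: dot_sqr_le.
Qed.

(** The Frobenius bound is what makes the supremum in [opnorm] a true supremum. *)
Lemma opnorm_ubound m n (A : 'M[R]_(m, n)) t (v : 'cV_n) :
  opnorm A <= t -> dot (A *m v) (A *m v) <= t ^+ 2 * dot v v.
Proof.
rewrite /opnorm; set E := [set _ | _ in _] => At.
have ubE : has_ubound E.
  exists (Num.sqrt (\sum_i dot (row i A)^T (row i A)^T)) => _ [w /= w1 <-].
  rewrite l2normE ler_wsqrtr// (le_trans (dot_mulmx_le_frobenius _ _))//.
  rewrite ler_piMr//; first by apply: sumr_ge0 => i _; exact: dot_ge0.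
  by rewrite -l2norm_sqr expr_le1// l2normE sqrtr_ge0.
have [v0|v0] := eqVneq (dot v v) 0.
  by rewrite (dot_eq0 v0) mulmx0 !dot0l mulr0.
have vp : 0 < l2norm v by rewrite l2normE sqrtr_gt0 lt_neqAle eq_sym v0 dot_ge0.
have : E (l2norm (A *m ((l2norm v)^-1 *: v))).
  exists ((l2norm v)^-1 *: v) => //=.
  rewrite l2normE dotZl dotZr -l2norm_sqr expr2 mulKf ?gt_eqF//.
  by rewrite mulVf ?gt_eqF// sqrtr1.
move=> /(ub_le_sup ubE) /le_trans /(_ At) H.
have : l2norm (A *m ((l2norm v)^-1 *: v)) ^+ 2 <= t ^+ 2.
  by rewrite lerXn2r// nnegrE ?(le_trans _ H)// l2normE sqrtr_ge0.
rewrite l2norm_sqr -scalemxAr dotZl dotZr mulrA -expr2 exprVn l2norm_sqr.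
by rewrite mulrC ler_pdivrMr// -l2norm_sqr exprn_gt0.
Qed.

Lemma dot_trmx_le m n (A : 'M[R]_(m, n)) t (w : 'cV_m) : 0 <= t ->
  (forall v, dot (A *m v) (A *m v) <= t * dot v v) ->
  dot (A^T *m w) (A^T *m w) <= t * dot w w.
Proof.
move=> t0 At; set v := A^T *m w.
have vv : dot v v = dot w (A *m v) by rewrite {1}/v dot_mull trmxK.
have H := le_trans (dot_sqr_le w (A *m v)) (ler_wpM2l (dot_ge0 w) (At v)).
have := dot_ge0 v; rewrite le_eqVlt => /orP[/eqP <-|v0].
  by rewrite mulr_ge0 ?dot_ge0.
rewrite -vv in H; rewrite -(ler_pM2l v0) -expr2 (le_trans H)//.
by rewrite mulrCA mulrA mulrC.
Qed.

End operator_norm.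

Section head_tail.
Context {R : realType} {n : nat}.
Variables (mh : 'rV[R]_n) (lam : R).
Hypothesis mh_decr : forall i j : 'I_n, (i <= j)%N -> mh 0 j <= mh 0 i.

Let hidx := @head_idx R n mh lam.
Let tidx := @tail_idx R n mh lam.

Lemma sum_head_tail (f : 'I_n -> R) :
  \sum_i f i = \sum_k f (hidx k) + \sum_k f (tidx k).
Proof.
rewrite (reindex (cast_ord (subnKC (s_emp_le mh lam)))) /=; last first.
  by apply: onW_bij; exact: (Bijective (cast_ordK _) (cast_ordKV _)).
rewrite big_split_ord /=; congr (_ + _); apply: eq_bigr => k _.
by congr f; apply: val_inj.
Qed.

Lemma head_gt k : lam < mh 0 (hidx k).
Proof.
have kn : (hidx k < s_emp mh lam)%N by case: k.
by have := before_find (hidx k) kn; rewrite nth_ord_enum /= ltNge => ->.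
Qed.

Lemma tail_le k : mh 0 (tidx k) <= lam.
Proof.
have sn : (s_emp mh lam < n)%N.
  by rewrite -subn_gt0 (leq_ltn_trans _ (ltn_ord k)).
have : has (fun i => mh 0 i <= lam) (enum 'I_n).
  by rewrite has_find size_enum_ord.
move=> /(nth_find (tidx k)) /(le_trans _); apply; apply: mh_decr.
by rewrite nth_enum_ord//= leq_addr.
Qed.

End head_tail.

Section satisfiable_bias.
Context {R : realType} {n s : nat}.
Variables (K : 'M[R]_n) (S : 'M[R]_(s, n)) (lam c F : R) (z : 'cV[R]_n).
Hypotheses (psdK : psdmx K) (lam_gt0 : 0 < lam) (F_ge0 : 0 <= F).
Hypothesis zK : forall a, dot a z ^+ 2 <= F * dot a (K *m a).

(** Satisfiability allows a sketched vector [b = S^T th] that interpolates [z]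
    on the leading eigenvectors: since [B = S U1] is close to an isometry,
    [B^T th = D1^-1 g1] can be solved with [|th|^2 <= 2 |D1^-1 g1|^2]. On the
    remaining eigenvectors the second condition keeps [b] small, and [z] itself
    is small there. Both smallness claims come from [zK], tested on
    [U1 D1^-1 g1] and on [U2 g2]. [sketched_bias] compares the fit with [b]. *)
Lemma bias_satisfiable : K_satisfiable c lam K S ->
  dot (z - K *m sketched_coef K lam S z) (z - K *m sketched_coef K lam S z) <=
  (3 + 6 * c ^+ 2) * (lam * F).
Proof.
move=> [U [mh [[KU UU decr mh0] /= op1 op2]]].
set hidx := @head_idx R n mh lam in op1.
set tidx := @tail_idx R n mh lam in op2.
have UtU : U^T *m U = 1%:M by exact: mulmx1C.
set g := U^T *m z.
have dotK b : dot b (K *m b) = \sum_i mh 0 i * (U^T *m b) i 0 ^+ 2.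
  rewrite KU -!mulmxA -{1}[U]trmxK -dot_mull; move: (U^T *m b) => w.
  by apply: eq_bigr => i _; rewrite mul_diag_mx mxE; ring.
have zKg (al : 'cV_n) : (\sum_i al i 0 * g i 0) ^+ 2 <=
    F * \sum_i mh 0 i * al i 0 ^+ 2.
  have := zK (U *m al); rewrite dot_mull dotK mulmxA UtU mul1mx.
  exact.
set B := S *m colsub hidx U in op1.
have Bge (u : 'cV_(s_emp mh lam)) : dot u u <= 2 * dot (B *m u) (B *m u).
  have := opnorm_ubound u op1.
  have := dot_sqr_le u ((B^T *m B - 1%:M) *m u).
  rewrite mulmxBl mul1mx -mulmxA; set d := dot (_ - u) (_ - u).
  rewrite !dotE -dot_mull.
  move=> H1 /(ler_wpM2l (dot_ge0 u)) H2; have a0 := dot_ge0 u.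
  have : (dot (B *m u) (B *m u) - dot u u) ^+ 2 <= (dot u u / 2) ^+ 2.
    by apply: le_trans H1 (le_trans H2 _); lra.
  move=> /(ler_abs_of_sqr (divr_ge0 a0 (ler0n _ 2))); lra.
have Gu : B^T *m B \in unitmx.
  apply: unitmx_ker0 => u /(congr1 (dot u)).
  rewrite (dotC _ 0) dot0l -mulmxA -dot_mull => B0.
  by apply: dot_eq0; have := Bge u; have := dot_ge0 u; lra.
pose h : 'cV_(s_emp mh lam) := \col_k (g (hidx k) 0 / mh 0 (hidx k)).
pose u := invmx (B^T *m B) *m h.
pose th := B *m u; pose b := S^T *m th; pose e := U^T *m b.
have Bth : B^T *m th = h by rewrite /th /u mulmxA mulmxA mulmxV ?mul1mx.
have th_le : dot th th <= 2 * dot h h.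
  have thh : dot th th = dot u h by rewrite {1}/th dot_mull Bth.
  have := Bge u; rewrite -/th; have := dot_sqr_le u h; rewrite -thh.
  move=> H1 /(ler_wpM2r (dot_ge0 h)) /(le_trans H1) H2.
  have := dot_ge0 th; rewrite le_eqVlt => /orP[/eqP <-|th0].
    by rewrite mulr_ge0// dot_ge0.
  by rewrite -(ler_pM2l th0) -expr2 (le_trans H2)// -mulrA mulrCA.
have eh k : e (hidx k) 0 = g (hidx k) 0 / mh 0 (hidx k).
  have -> : e (hidx k) 0 = (B^T *m th) k 0; last by rewrite Bth mxE.
  rewrite /e /b mulmxA -trmx_mul !mxE; apply: eq_bigr => j _.
  by congr (_ * _); rewrite !mxE; apply: eq_bigr => l _; rewrite !mxE.
have et : \sum_k mh 0 (tidx k) * e (tidx k) 0 ^+ 2 <= c ^+ 2 * lam * dot th th.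
  have cl0 : 0 <= c ^+ 2 * lam by rewrite mulr_ge0 ?sqr_ge0 ?ltW.
  apply: le_trans (@dot_trmx_le _ _ _ (S *m colsub tidx U *m
    diag_mx (\row_j Num.sqrt (mh 0 (tidx j)))) _ th cl0 _).
    rewrite le_eqVlt; apply/orP; left; apply/eqP; apply: eq_bigr => k _.
    rewrite trmx_mul tr_diag_mx -mulmxA mul_diag_mx.
    have : ((S *m colsub tidx U)^T *m th) k 0 = e (tidx k) 0.
      rewrite /e /b mulmxA -trmx_mul !mxE; apply: eq_bigr => j _.
      by congr (_ * _); rewrite !mxE; apply: eq_bigr => l _; rewrite !mxE.
    move: (_ *m th) (e _ _) => w x wk; rewrite !mxE wk.
    by rewrite mulrACA -expr2 -expr2 sqr_sqrtr ?mh0.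
  move=> v; have := opnorm_ubound v op2.
  by rewrite exprMn (sqr_sqrtr (ltW lam_gt0)).
have hg k : 0 < mh 0 (hidx k) by rewrite (lt_trans lam_gt0)// head_gt.
have tg k : mh 0 (tidx k) <= lam by exact: tail_le.
have Hle : \sum_k g (hidx k) 0 ^+ 2 / mh 0 (hidx k) <= F.
  pose al : 'cV_n := \col_i if lam < mh 0 i then g i 0 / mh 0 i else 0.
  have := zKg al; rewrite !(sum_head_tail mh lam).
  rewrite [X in (_ + X) ^+ 2]big1 ?addr0; last first.
    by move=> k _; rewrite mxE ltNge tg mul0r.
  rewrite [X in F * (_ + X)]big1 ?addr0; last first.
    by move=> k _; rewrite mxE ltNge tg expr0n mulr0.
  have gm k : mh 0 (hidx k) * al (hidx k) 0 ^+ 2 =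
      g (hidx k) 0 ^+ 2 / mh 0 (hidx k).
    by rewrite mxE head_gt; field; rewrite gt_eqF.
  have gg k : al (hidx k) 0 * g (hidx k) 0 = g (hidx k) 0 ^+ 2 / mh 0 (hidx k).
    by rewrite mxE head_gt; field; rewrite gt_eqF.
  rewrite (eq_bigr _ (fun k _ => gg k)) (eq_bigr _ (fun k _ => gm k)).
  apply: le_of_sqr_le => //; apply: sumr_ge0 => k _.
  by rewrite divr_ge0 ?sqr_ge0// ltW.
have Tle : \sum_k g (tidx k) 0 ^+ 2 <= lam * F.
  pose al : 'cV_n := \col_i if lam < mh 0 i then 0 else g i 0.
  have := zKg al; rewrite !(sum_head_tail mh lam).
  rewrite [X in (X + _) ^+ 2]big1 ?add0r; last first.
    by move=> k _; rewrite mxE head_gt mul0r.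
  rewrite [X in F * (X + _)]big1 ?add0r; last first.
    by move=> k _; rewrite mxE head_gt expr0n mulr0.
  have alE k : al (tidx k) 0 = g (tidx k) 0 by rewrite mxE ltNge tg.
  move=> H; apply: le_of_sqr_le.
  - by apply: sumr_ge0 => k _; exact: sqr_ge0.
  - by rewrite mulr_ge0// ltW.
  - rewrite (eq_bigr (fun k => al (tidx k) 0 * g (tidx k) 0)); last first.
      by move=> k _; rewrite alE expr2.
    apply: le_trans H _; rewrite (mulrC lam) -mulrA ler_wpM2l// mulr_sumr.
    by apply: ler_sum => k _; rewrite alE -expr2 ler_wpM2r ?sqr_ge0.
have hh : dot h h <= F / lam.
  rewrite ler_pdivlMr//; apply: le_trans Hle; rewrite mulr_suml; apply: ler_sum => k _.
  have -> : h k 0 * h k 0 * lam =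
      g (hidx k) 0 ^+ 2 / mh 0 (hidx k) * (lam / mh 0 (hidx k)).
    by rewrite mxE; field; rewrite gt_eqF.
  rewrite ler_piMr ?divr_ge0 ?sqr_ge0 ?(ltW (hg k))//.
  by rewrite ler_pdivrMr// mul1r ltW// head_gt.
apply: le_trans (sketched_bias psdK lam_gt0 S z th) _; rewrite -/b.
have -> : dot (z - K *m b) (z - K *m b) =
    \sum_i (g i 0 - mh 0 i * e i 0) ^+ 2.
  have -> : z - K *m b = U *m (g - diag_mx mh *m e).
    by rewrite mulmxBr /g /e !mulmxA UU mul1mx -KU.
  rewrite dot_mull (mulmxA U^T) UtU mul1mx; apply: eq_bigr => i _.
  by rewrite mul_diag_mx -expr2; congr (_ ^+ 2); rewrite !mxE.
rewrite dotK -/e !(sum_head_tail mh lam) -/hidx -/tidx.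
rewrite [X in X + _ + _ <= _]big1 ?add0r; last first.
  by move=> k _; rewrite eh mulrCA divff ?mulr1 ?subrr ?expr0n// gt_eqF.
have -> : \sum_k mh 0 (hidx k) * e (hidx k) 0 ^+ 2 =
    \sum_k g (hidx k) 0 ^+ 2 / mh 0 (hidx k).
  by apply: eq_bigr => k _; rewrite eh; field; rewrite gt_eqF.
have T2 : \sum_k (g (tidx k) 0 - mh 0 (tidx k) * e (tidx k) 0) ^+ 2 <=
    2 * (\sum_k g (tidx k) 0 ^+ 2) +
    2 * lam * (\sum_k mh 0 (tidx k) * e (tidx k) 0 ^+ 2).
  rewrite !mulr_sumr -big_split /=; apply: ler_sum => k _.
  have := tg k; have := mh0 (tidx k); move: (mh 0 _) (e _ _) (g _ _) => m x y m0 ml.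
  have : 0 <= m * (lam - m) * x ^+ 2 by rewrite mulr_ge0 ?sqr_ge0// mulr_ge0// subr_ge0.
  by have := sqr_ge0 (y + m * x); nra.
have lamF : lam * (F / lam) = F by rewrite mulrC divfK// gt_eqF.
have et2 : \sum_k mh 0 (tidx k) * e (tidx k) 0 ^+ 2 <= c ^+ 2 * (2 * F).
  apply: le_trans et _; rewrite -mulrA ler_wpM2l ?sqr_ge0//.
  apply: le_trans (ler_wpM2l (ltW lam_gt0) (le_trans th_le (ler_wpM2l _ hh))) _ => //.
  by rewrite mulrCA lamF.
move: T2 (ler_wpM2l (ltW lam_gt0) et2) (ler_wpM2l (ltW lam_gt0) Hle) Tle.
lra.
Qed.

End satisfiable_bias.

(** * Kernel matrices of a reproducing kernel Hilbert space *)

Section reproducing_kernel.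
Context {R : realType} {T : Type} {H : set (T -> R)}.
Context {ip : (T -> R) -> (T -> R) -> R} {K : T -> T -> R}.
Hypothesis rkhs : is_rkhs H ip K.

Lemma rkhs_ip0l f : H f -> ip (fun=> 0) f = 0.
Proof.
move=> Hf; have H0 := rkhs_zero rkhs.
have := rkhs_ip_lin rkhs (-1) H0 H0 Hf.
rewrite (_ : (fun t : T => _) = (fun=> 0)); last by apply/funext=> t; rewrite mulr0 addr0.
by move=> ->; rewrite mulN1r addNr.
Qed.

Lemma rkhs_scale a f : H f -> H (fun t => a * f t).
Proof.
move=> Hf; have := rkhs_lin rkhs a Hf (rkhs_zero rkhs).
by under eq_fun do rewrite addr0.
Qed.

Lemma rkhs_ip_scale a f g : H f -> H g -> ip (fun t => a * f t) g = a * ip f g.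
Proof.
move=> Hf Hg; have := rkhs_ip_lin rkhs a Hf (rkhs_zero rkhs) Hg.
by under eq_fun do rewrite addr0; rewrite rkhs_ip0l// addr0.
Qed.

Lemma rkhs_cauchy_schwarz f g : H f -> H g ->
  ip f g ^+ 2 <= ip f f * ip g g.
Proof.
move=> Hf Hg; have := rkhs_ip_ge0 rkhs Hg.
rewrite le_eqVlt => /orP[/eqP g0|g0].
  rewrite (rkhs_ip_eq0 rkhs Hg (esym g0)) (rkhs_ip_sym rkhs Hf (rkhs_zero rkhs)).
  by rewrite !rkhs_ip0l ?expr0n ?mulr0//; exact: rkhs_zero rkhs.
have Hbg := rkhs_scale (- ip f g) Hg.
have Hh := rkhs_lin rkhs (ip g g) Hf Hbg.
have := rkhs_ip_ge0 rkhs Hh.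
rewrite (rkhs_ip_lin rkhs) // (rkhs_ip_sym rkhs Hf Hh) (rkhs_ip_sym rkhs Hbg Hh).
rewrite !(rkhs_ip_lin rkhs)// !(rkhs_ip_sym rkhs Hf Hbg).
rewrite !rkhs_ip_scale// (rkhs_ip_sym rkhs Hg Hbg) rkhs_ip_scale//.
rewrite (rkhs_ip_sym rkhs Hg Hf) => h0.
have : 0 <= ip g g * (ip f f * ip g g - ip f g ^+ 2) by lra.
by rewrite pmulr_rge0// subr_ge0.
Qed.

Lemma rkhs_kernelC s t : K s t = K t s.
Proof.
have Hk := rkhs_kernel rkhs.
rewrite -(rkhs_reproducing rkhs t (Hk s)) -(rkhs_reproducing rkhs s (Hk t)).
exact: (rkhs_ip_sym rkhs (Hk s) (Hk t)).
Qed.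

Definition kernel_comb n (x : 'I_n -> T) (a : 'cV[R]_n) : T -> R :=
  fun t => \sum_i a i 0 * K (x i) t.

Lemma kernel_combP n (x : 'I_n -> T) (a : 'cV[R]_n) : H (kernel_comb x a) /\
  forall f, H f -> ip (kernel_comb x a) f = dot a (\col_i f (x i)).
Proof.
rewrite /kernel_comb /dot; under [in X in _ /\ X]eq_forall do
  under [in X in _ = X]eq_bigr do rewrite mxE.
elim: (index_enum _) => [|i r [Hr ipr]].
  under eq_fun do rewrite big_nil.
  split=> [|f Hf]; first exact: rkhs_zero rkhs.
  by rewrite big_nil rkhs_ip0l.
have Hk := rkhs_kernel rkhs (x i).
under eq_fun do rewrite big_cons.
split=> [|f Hf]; first exact: rkhs_lin rkhs _ _ _ Hk Hr.
rewrite big_cons (rkhs_ip_lin rkhs)// ipr// (rkhs_ip_sym rkhs Hk Hf).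
by rewrite (rkhs_reproducing rkhs).
Qed.

Variables (n : nat) (x : 'I_n -> T).
Hypothesis n_gt0 : (0 < n)%N.

Lemma kernel_comb_ip (a : 'cV[R]_n) :
  ip (kernel_comb x a) (kernel_comb x a) = n%:R * dot a (kernel_mx K x *m a).
Proof.
have [Hg ->//] := kernel_combP x a.
rewrite -dotZr; congr dot; apply/colP => i; rewrite !mxE mulr_sumr.
apply: eq_bigr => j _; rewrite mxE mulrA mulrA divff ?pnatr_eq0 -?lt0n//.
by rewrite mul1r mulrC rkhs_kernelC.
Qed.

Lemma kernel_mx_psd : psdmx (kernel_mx K x).
Proof.
split; first by apply/matrixP => i j; rewrite !mxE rkhs_kernelC.
move=> a; have [Hg _] := kernel_combP x a.
have := rkhs_ip_ge0 rkhs Hg; rewrite kernel_comb_ip pmulr_rge0//.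
by rewrite ltr0n.
Qed.

(** Duality between the Hilbert norm and the kernel matrix: [a . f(x)] is the
    inner product of [f] with [kernel_comb x a], whose squared norm is
    [n (a . Km a)]. For [f = f0] this is the smoothness of the regression
    function that bounds the bias; for [f = phi i] it says that [Km] dominates
    the rank one matrix of the [i]-th eigenfunction. *)
Lemma kernel_mx_dual f (a : 'cV[R]_n) : H f ->
  dot a (\col_i f (x i)) ^+ 2 <=
  (n%:R * ip f f) * dot a (kernel_mx K x *m a).
Proof.
move=> Hf; have [Hg ipg] := kernel_combP x a.
rewrite -ipg// (le_trans (rkhs_cauchy_schwarz Hg Hf))//.
by rewrite kernel_comb_ip mulrAC.
Qed.

End reproducing_kernel.

(** * Effective dimension of the kernel matrix *)

Section effective_dimension.
Context {R : realType} {T : Type} {H : set (T -> R)}.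
Context {ip : (T -> R) -> (T -> R) -> R} {K : T -> T -> R}.
Hypothesis rkhs : is_rkhs H ip K.
Variables (mu : nat -> R) (phi : nat -> T -> R) (C : R).
Hypothesis mu_ge0 : forall i, 0 <= mu i.
Hypothesis phi_H : forall i, H (phi i).
Hypothesis phi_ip : forall i, ip (phi i) (phi i) = (mu i)^-1.
Hypothesis phi_bound : forall i t, `|phi i t| <= C.
Hypothesis mercer : forall x x',
  (\sum_(i < N) mu i * phi i x * phi i x') @[N --> \oo] --> K x x'.
Variables (n : nat) (x : 'I_n -> T) (lam : R).
Hypotheses (n_gt0 : (0 < n)%N) (lam_gt0 : 0 < lam).

Let Km := kernel_mx K x.
Let W := resolvent Km lam.
Let v i : 'cV[R]_n := \col_j phi i (x j).

Let psdK : psdmx Km := kernel_mx_psd rkhs x n_gt0.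

Let spectral_term i := n%:R^-1 * mu i * dot (v i) (W *m v i).

Lemma trace_ridge_cvg :
  (\sum_(i < N) spectral_term i) @[N --> \oo] --> \tr (ridge_smoother Km lam).
Proof.
have -> : \tr (ridge_smoother Km lam) = 
    \sum_a \sum_b n%:R^-1 * K (x a) (x b) * W b a.
  by apply: eq_bigr => a _; rewrite mxE; apply: eq_bigr => b _; rewrite mxE.
have -> : (fun N => \sum_(i < N) spectral_term i) = (fun N => \sum_a \sum_b
    n%:R^-1 * (\sum_(i < N) mu i * phi i (x a) * phi i (x b)) * W b a).
  apply/funext => N; under [RHS]eq_bigr do under eq_bigr do
    rewrite mulr_sumr mulr_suml.
  under [RHS]eq_bigr do rewrite exchange_big/=.
  rewrite [RHS]exchange_big/=; apply: eq_bigr => i _.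
  rewrite exchange_big/= /spectral_term /dot mulr_sumr; apply: eq_bigr => b _.
  rewrite mxE (mxE _ _ b) mulr_sumr mulr_sumr; apply: eq_bigr => a _.
  by rewrite mxE; ring.
apply: cvg_big => [|a _]; first exact: add_continuous.
apply: cvg_big => [|b _]; first exact: add_continuous.
apply: cvgMr_tmp; apply: cvgMl_tmp; exact: mercer.
Qed.

Lemma spectral_term_le1 i : spectral_term i <= 1.
Proof.
apply: (resolvent_dot_le1 psdK lam_gt0) => u.
have := mu_ge0 i; rewrite le_eqVlt => /orP[/eqP <-|mu0].
  by rewrite mulr0 mul0r psdK.2.
rewrite -mulrA ler_pdivrMl ?ltr0n// -ler_pdivlMl//.
have := kernel_mx_dual rkhs x n_gt0 u (phi_H i).
by rewrite phi_ip dotC -mulrA mulrCA.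
Qed.

Lemma spectral_term_le i : spectral_term i <= C ^+ 2 / lam * mu i.
Proof.
have n0 : 0 < n%:R :> R by rewrite ltr0n.
have vv : dot (v i) (v i) <= n%:R * C ^+ 2.
  rewrite mulr_natl -[X in _ *+ X](card_ord n) -sumr_const; apply: ler_sum => j _.
  rewrite !mxE -expr2 -real_normK ?num_real//.
  by rewrite lerXn2r ?nnegrE// (le_trans _ (phi_bound i (x j))).
have := le_trans (resolvent_dot_le psdK lam_gt0 (v i)) vv.
rewrite mulrC -ler_pdivlMr// => vWv.
rewrite /spectral_term -mulrA ler_pdivrMl//.
apply: le_trans (ler_wpM2l (mu_ge0 i) vWv) _.
by rewrite le_eqVlt; apply/orP; left; apply/eqP; field; rewrite gt_eqF.
Qed.

(** The trace of the ridge smoother, summed along the Mercer expansion: each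
    eigenfunction contributes at most [1] because its rank one matrix lies below
    [Km], and at most [C^2 mu i / lam] because it is bounded by [C] and the
    resolvent by [1 / lam]. Using the first bound for [i < k] and the second one
    beyond gives an estimate that holds for every design. *)
Lemma trace_ridge_le k t :
  (forall N, (k <= N)%N -> \sum_(k <= i < N) mu i <= t) ->
  \tr (ridge_smoother Km lam) <= k%:R + C ^+ 2 / lam * t.
Proof.
move=> tail; have Tc := trace_ridge_cvg.
rewrite -(cvg_lim _ Tc)//; apply: limr_le; first by apply/cvg_ex; eexists; exact: Tc.
exists k => // N /= kN; rewrite -(big_mkord xpredT spectral_term) (big_cat_nat (leq0n k) kN)//=.
apply: lerD.
  apply: le_trans (_ : \sum_(0 <= i < k) 1 <= _); last first.
    by rewrite sumr_const_nat subn0.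
  by apply: ler_sum => i _; exact: spectral_term_le1.
apply: le_trans (_ : \sum_(k <= i < N) C ^+ 2 / lam * mu i <= _).
  by apply: ler_sum => i _; exact: spectral_term_le.
by rewrite -mulr_sumr ler_wpM2l ?tail// divr_ge0 ?sqr_ge0// ltW.
Qed.

End effective_dimension.

(** * Products of independent random variables *)

Section independence.
Context d d1 d2 (Omega : measurableType d) (T1 : measurableType d1)
  (T2 : measurableType d2) (R : realType) (P : probability Omega R).
Variables (X : {RV P >-> T1}) (Y : {RV P >-> T2}) (f : T1 -> R) (g : T2 -> R).
Hypothesis indepXY : forall A B, measurable A -> measurable B ->
  P (X @^-1` A `&` Y @^-1` B) = (P (X @^-1` A) * P (Y @^-1` B))%E.
Hypotheses (mf : measurable_fun setT f) (mg : measurable_fun setT g).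
Hypothesis iX : P.-integrable setT (EFin \o (f \o X)).
Hypothesis iY : P.-integrable setT (EFin \o (g \o Y)).

Let mXY : measurable_fun setT (fun w => (X w, Y w)).
Proof. by apply/measurable_fun_pairP; split => /=; exact: measurable_funPT. Qed.

Let joint : {RV P >-> (T1 * T2)%type} :=
  HB.pack (fun w => (X w, Y w)) (isMeasurableFun.Build _ _ _ _ _ mXY).

Let mu1 := distribution P X.
Let mu2 := distribution P Y.

Let prodfg (z : T1 * T2) := (f z.1 * g z.2)%:E.

Let mprodfg : measurable_fun setT prodfg.
Proof.
by apply/measurable_EFinP; apply: measurable_funM; apply: measurableT_comp.
Qed.

(** Independence identifies the joint law with the product of the marginals, so
    that the theorems of Fubini and Tonelli apply. *)
Let jointE A : measurable A -> (mu1 \x mu2)%E A = distribution P joint A.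
Proof.
apply: product_measure_unique => A' B' mA mB.
by rewrite -indepXY.
Qed.

Let mabsf : measurable_fun setT (fun x => `|(f x)%:E|%E).
Proof. by apply: measurableT_comp => //; exact/measurable_EFinP. Qed.

Let mabsg : measurable_fun setT (fun x => `|(g x)%:E|%E).
Proof. by apply: measurableT_comp => //; exact/measurable_EFinP. Qed.

Let i1 : mu1.-integrable setT (EFin \o f).
Proof.
apply/integrableP; split; first exact/measurable_EFinP.
by rewrite /mu1 ge0_integral_distribution//; case/integrableP: iX.
Qed.

Let i2 : mu2.-integrable setT (EFin \o g).
Proof.
apply/integrableP; split; first exact/measurable_EFinP.
by rewrite /mu2 ge0_integral_distribution//; case/integrableP: iY.
Qed.

Let iprodfg : (mu1 \x mu2)%E.-integrable setT prodfg.
Proof.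
apply/integrable12ltyP => //=.
have -> : (\int[mu1]_x \int[mu2]_y `|prodfg (x, y)|)%E =
    (\int[mu1]_x (`|(f x)%:E| * \int[mu2]_y `|(g y)%:E|))%E.
  apply: eq_integral => x _; rewrite -ge0_integralZl//.
  by apply: eq_integral => y _; rewrite -abseM -EFinM.
rewrite ge0_integralZr//; last by apply: integral_ge0.
case/integrableP: i1 => _ /= f1; case/integrableP: i2 => _ /= g1.
by apply: lte_mul_pinfty => //; rewrite ?ge0_fin_numE ?integral_ge0.
Qed.

Lemma integrable_indep_mul :
  P.-integrable setT (fun w => (f (X w) * g (Y w))%:E).
Proof.
apply/integrableP; split.
  apply/measurable_EFinP; apply: measurable_funM; apply: measurableT_comp => //.
have -> : (\int[P]_w `|(f (X w) * g (Y w))%:E| =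
    \int[distribution P joint]_z `|prodfg z|)%E.
  by rewrite ge0_integral_distribution//; apply: measurableT_comp.
rewrite (eq_measure_integral (mu1 \x mu2)%E); last first.
  by move=> A mA _; rewrite [RHS]jointE.
by case/integrableP: iprodfg.
Qed.

Lemma integral_indep_mul :
  (\int[P]_w (f (X w) * g (Y w))%:E =
   (\int[P]_w (f (X w))%:E) * (\int[P]_w (g (Y w))%:E))%E.
Proof.
have -> : (\int[P]_w (f (X w) * g (Y w))%:E =
    \int[distribution P joint]_z prodfg z)%E.
  by rewrite integral_distribution//; exact: integrable_indep_mul.
rewrite (eq_measure_integral (mu1 \x mu2)%E); last first.
  by move=> A mA _; rewrite [RHS]jointE.
rewrite -integral12_prod_meas1//=.
have XE : (\int[mu1]_x (f x)%:E = \int[P]_w (f (X w))%:E)%E.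
  by rewrite integral_distribution//; apply/measurable_EFinP.
have YE : (\int[mu2]_x (g x)%:E = \int[P]_w (g (Y w))%:E)%E.
  by rewrite integral_distribution//; apply/measurable_EFinP.
transitivity (\int[mu1]_x ((f x)%:E * \int[mu2]_y (g y)%:E))%E.
  by apply: eq_integral => x _; rewrite -integralZl.
have := integrable_fin_num measurableT i2; rewrite -YE -XE /=.
by move=> /fineK <-; rewrite integralZr.
Qed.

End independence.

(** * Measurability of the ridge smoother *)

Section measurable_matrix.
Context d (Omega : measurableType d) (R : realType).

Lemma measurable_funV (f : Omega -> R) : measurable_fun setT f ->
  (forall w, f w != 0) -> measurable_fun setT (fun w => (f w)^-1).
Proof.
move=> mf f0.
(* The square makes the logarithm legitimate for either sign of [f w]. *)
have -> : (fun w => (f w)^-1) = (fun w => f w * expR (- ln (f w ^+ 2))).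
  apply/funext => w; have f2 : 0 < f w ^+ 2 by rewrite exprn_even_gt0 ?f0.
  by rewrite expRN lnK// expr2 invfM mulrA divff// mul1r.
apply: measurable_funM => //.
apply: measurableT_comp; first exact: measurable_expR.
apply: measurable_funN; apply: measurableT_comp; first exact: measurable_ln.
exact: measurable_funX.
Qed.

Lemma measurable_det n (A : Omega -> 'M[R]_n) :
  (forall i j, measurable_fun setT (fun w => A w i j)) ->
  measurable_fun setT (fun w => \det (A w)).
Proof.
move=> mA; rewrite /determinant; apply: measurable_sum => s.
apply: measurable_funM => //.
by apply: measurable_prod => i _; exact: mA.
Qed.

Lemma measurable_mulmx m n p (A : Omega -> 'M[R]_(m, n))
    (B : Omega -> 'M[R]_(n, p)) :
  (forall i j, measurable_fun setT (fun w => A w i j)) ->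
  (forall i j, measurable_fun setT (fun w => B w i j)) ->
  forall i j, measurable_fun setT (fun w => (A w *m B w) i j).
Proof.
move=> mA mB i j; under eq_fun do rewrite mxE.
by apply: measurable_sum => k; exact: measurable_funM.
Qed.

Lemma measurable_invmx n (A : Omega -> 'M[R]_n) :
  (forall i j, measurable_fun setT (fun w => A w i j)) ->
  (forall w, A w \in unitmx) ->
  forall i j, measurable_fun setT (fun w => invmx (A w) i j).
Proof.
move=> mA uA i j; under eq_fun do rewrite /invmx uA !mxE.
apply: measurable_funM.
  apply: measurable_funV; first exact: measurable_det.
  by move=> w; have := uA w; rewrite unitmxE unitfE.
apply: measurable_funM => //; apply: measurable_det => k l.
by under eq_fun do rewrite !mxE; exact: mA.
Qed.

Lemma measurable_ridge_smoother n (A : Omega -> 'M[R]_n) lam :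
  (forall i j, measurable_fun setT (fun w => A w i j)) ->
  (forall w, psdmx (A w)) -> 0 < lam ->
  forall i j, measurable_fun setT (fun w => ridge_smoother (A w) lam i j).
Proof.
move=> mA pA lam0; apply: measurable_mulmx => //; apply: measurable_invmx.
  by move=> i j; under eq_fun do rewrite mxE; exact: measurable_funD.
by move=> w; exact: psd_shift_unit.
Qed.

End measurable_matrix.

Lemma g_sigma_preimage_measurable_fun dT (T : measurableType dT)
    (Omega : pointedType) n (f : 'I_n -> Omega -> T) i :
  measurable_fun (setT : set (g_sigma_algebraType
    (\big[setU/set0]_(i < n) preimage_set_system setT (f i) measurable))) (f i).
Proof.
move=> _ A mA; apply: sub_sigma_algebra; rewrite (bigD1 i)//=; left.
by exists A.
Qed.

(** * Moments of the standard normal law *)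

Section gaussian_moments.
Context d (Omega : measurableType d) (R : realType) (P : probability Omega R).
Variable X : {RV P >-> R}.
Hypothesis X_normal : forall A, measurable A ->
  distribution P X A = normal_prob 0 1 A.

Local Notation leb := (@lebesgue_measure R).
Local Notation pdf := (@normal_pdf R 0 1).

(** By uniqueness of Radon-Nikodym derivatives, the derivative of the normal law
    is almost everywhere its density. *)
Lemma ge0_integral_normal_prob (f : R -> \bar R) :
  measurable_fun setT f -> (forall x, 0 <= f x)%E ->
  (\int[normal_prob (0 : R) 1]_x f x = \int[leb]_x (f x * (pdf x)%:E))%E.
Proof.
move=> mf f0; have dom := normal_prob_dominates (0 : R) 1.
rewrite -(Radon_Nikodym_SigmaFinite.change_of_variables dom)//.
have fi := Radon_Nikodym_SigmaFinite.f_integrable dom.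
apply: ae_eq_integral => //.
- by apply: emeasurable_funM => //; exact: measurable_int fi.
- apply: emeasurable_funM => //; apply/measurable_EFinP.
  exact: measurable_normal_pdf.
- apply: ae_eqe_mul2l; apply: integral_ae_eq => //.
    by apply/measurable_EFinP; exact: measurable_normal_pdf.
  by move=> E _ mE; rewrite -Radon_Nikodym_SigmaFinite.f_integral.
Qed.

Let idR : measurableTypeR R -> R := idfun.

Let midR : measurable_fun setT idR. Proof. exact: measurable_id. Qed.

(** [normal_prob] is a measure for the sigma-algebra of [measurableTypeR], whose
    display differs from the one that random variables take on [R]; its image
    under the identity is the same law for the latter. *)
Let normal_on_R : {mfun measurableTypeR R >-> R} :=
  HB.pack idR (isMeasurableFun.Build _ _ _ _ _ midR).

Lemma ge0_integral_gaussian (f : R -> \bar R) :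
  measurable_fun setT f -> (forall x, 0 <= f x)%E ->
  (\int[P]_w f (X w) = \int[leb]_x (f x * (pdf x)%:E))%E.
Proof.
move=> mf f0; rewrite -ge0_integral_normal_prob//.
rewrite -(ge0_integral_distribution X mf f0).
rewrite (eq_measure_integral (distribution (normal_prob (0 : R) 1) normal_on_R)).
  by rewrite ge0_integral_distribution.
by move=> A mA _; exact: X_normal.
Qed.

Let peak_ratio : R := normal_peak 1 / normal_peak 2.

(** A wider Gaussian absorbs the square: [x^2 exp (- x^2 / 2)] is at most
    [8 exp (- x^2 / 8)], since [x^2 <= 8 exp (3 x^2 / 8)]. *)
Lemma sqr_normal_pdf_le (x : R) :
  x ^+ 2 * pdf x <= 8 * peak_ratio * normal_pdf 0 2 x.
Proof.
have p2 : normal_peak 2 != 0 :> R by rewrite gt_eqF// normal_peak_gt0.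
rewrite !normal_pdfE ?oner_eq0// /peak_ratio.
have -> : 8 * (normal_peak 1 / normal_peak 2) *
    (normal_peak 2 * normal_fun 0 2 x) = normal_peak 1 * (8 * normal_fun 0 2 x).
  by field.
rewrite mulrCA ler_wpM2l ?normal_peak_ge0// /normal_fun subr0.
have -> : - x ^+ 2 / (1 ^+ 2 *+ 2) =
    - (x ^+ 2 * 3 / 8) + - x ^+ 2 / (2 ^+ 2 *+ 2) :> R by field.
rewrite expRD mulrA ler_wpM2r ?expR_ge0// expRN ler_pdivrMr ?expR_gt0//.
have := expR_ge1Dx (x ^+ 2 * 3 / 8); have := sqr_ge0 x; lra.
Qed.

Lemma gaussian_sqr_integrable :
  P.-integrable setT (fun w => (X w ^+ 2)%:E).
Proof.
apply/integrableP; split.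
  by apply/measurable_EFinP; apply: measurable_funX; exact: measurable_funPT.
under eq_integral do rewrite gee0_abs ?lee_fin ?sqr_ge0//.
rewrite (ge0_integral_gaussian (f := fun x => (x ^+ 2)%:E)); last 2 first.
- by apply/measurable_EFinP; exact: measurable_funX.
- by move=> x; rewrite lee_fin sqr_ge0.
apply: (@le_lt_trans _ _ (\int[leb]_x ((8 * peak_ratio)%:E * (normal_pdf 0 2 x)%:E))%E).
  apply: ge0_le_integral => //.
  - by move=> x _; rewrite -EFinM lee_fin mulr_ge0 ?sqr_ge0 ?normal_pdf_ge0.
  - apply/measurable_EFinP; apply: measurable_funM.
      exact: measurable_funX.
    exact: measurable_normal_pdf.
  - apply/measurable_EFinP; apply: measurable_funM => //.
    exact: measurable_normal_pdf.
  - by move=> x _; rewrite -!EFinM lee_fin sqr_normal_pdf_le.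
rewrite integralZl//; last exact: integrable_normal_pdf.
by rewrite integral_normal_pdf mule1 ltry.
Qed.

Lemma gaussian_integrable : P.-integrable setT (fun w => (X w)%:E).
Proof.
have i1 : P.-integrable setT (cst (1%:E : \bar R)).
  exact: finite_measure_integrable_cst.
apply: le_integrable (integrableD measurableT i1 gaussian_sqr_integrable) => //.
  by apply/measurable_EFinP; exact: measurable_funPT.
move=> w _; rewrite /= lee_fin ler_norml; apply/andP.
rewrite ger0_norm ?addr_ge0 ?sqr_ge0//.
have := sqr_ge0 (X w - 1); have := sqr_ge0 (X w + 1); split; nra.
Qed.

(** The density is even, so the reflection of the line exchanges the integrals
    of the positive and negative parts, which are finite. *)
Lemma gaussian_mean0 : (\int[P]_w (X w)%:E = 0)%E.
Proof.
have mid : measurable_fun setT (EFin : R -> \bar R) by exact/measurable_EFinP.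
have mp := measurable_funepos mid; have mn := measurable_funeneg mid.
have fin := integrable_pos_fin_num measurableT gaussian_integrable.
have E : (\int[P]_w (EFin^\+ (X w)) = \int[P]_w (EFin^\- (X w)))%E.
  rewrite !ge0_integral_gaussian//.
  have -> : (\int[leb]_x (EFin^\+ x * (pdf x)%:E) =
      \int[leb]_(x in `[0%R, +oo[) (x * pdf x)%:E)%E.
    rewrite [RHS]integral_mkcond; apply: eq_integral => x _.
    rewrite patchE mem_setE in_itv/= andbT funeposE.
    have [x0|x0] := leP 0 x; first by rewrite max_l.
    by rewrite max_r ?lee_fin ?ltW// mul0e.
  have -> : (\int[leb]_x (EFin^\- x * (pdf x)%:E) =
      \int[leb]_(x in `]-oo, 0%R]) (- x * pdf x)%:E)%E.
    rewrite [RHS]integral_mkcond; apply: eq_integral => x _.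
    rewrite patchE mem_setE in_itv/= funenegE -EFinN.
    have [x0|x0] := leP x 0; first by rewrite max_l ?lee_fin ?oppr_ge0.
    by rewrite max_r ?lee_fin ?oppr_le0 ?ltW// mul0e.
  pose h (x : R) := (Num.max x 0 * pdf x)%:E.
  have -> : (\int[leb]_(x in `[0%R, +oo[) (x * pdf x)%:E =
      \int[leb]_(x in `[0%R, +oo[) h x)%E.
    by apply: eq_integral => x; rewrite mem_setE in_itv/= andbT /h => x0; rewrite max_l.
  rewrite ge0_integration_by_substitution0; last 2 first.
  - apply/measurable_EFinP; apply: measurable_funM.
      exact: measurable_maxr.
    exact: measurable_normal_pdf.
  - by move=> x; rewrite lee_fin mulr_ge0 ?normal_pdf_ge0// le_max lexx orbT.
  apply: eq_integral => x; rewrite mem_setE in_itv/= /h => x0.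
  rewrite max_l ?oppr_ge0//; congr (_ * _)%:E.
  by rewrite !normal_pdfE ?oner_eq0// /normal_fun !subr0 sqrrN.
have Ep : (fun w => (X w)%:E)^\+%E = (fun w => EFin^\+%E (X w)).
  by apply/funext => w; rewrite !funeposE.
have En : (fun w => (X w)%:E)^\-%E = (fun w => EFin^\-%E (X w)).
  by apply/funext => w; rewrite !funenegE.
by rewrite Ep in fin; rewrite integralE Ep En -E subee.
Qed.

End gaussian_moments.

(** * Mean of a quadratic form in the noise *)

Section quadratic_form.
Context d (Omega : measurableType d) (R : realType) (P : probability Omega R).
Variables (n : nat) (eps : 'I_n -> {RV P >-> R}).
Hypothesis eps_normal : forall i A, measurable A ->
  distribution P (eps i) A = normal_prob 0 1 A.
Hypothesis eps_indep : mutually_independent P (fun i => eps i : Omega -> R).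

Lemma mutually_independent_pair i j A B : i != j ->
  measurable A -> measurable B ->
  P (eps i @^-1` A `&` eps j @^-1` B) =
  (P (eps i @^-1` A) * P (eps j @^-1` B))%E.
Proof.
move=> ij mA mB.
(* The full set at the other indices removes them from the product rule. *)
pose C k := if k == i then A else if k == j then B else setT.
have mC k : measurable (C k) by rewrite /C; case: ifP => // _; case: ifP.
have Ci : C i = A by rewrite /C eqxx.
have Cj : C j = B by rewrite /C eq_sym (negbTE ij) eqxx.
have := eps_indep mC.
have -> : \bigcap_(k in [set: 'I_n]) (eps k @^-1` C k) =
    eps i @^-1` A `&` eps j @^-1` B.
  apply/seteqP; split=> w /=.
    by move=> Cw; split; [rewrite -Ci; exact: (Cw i)|rewrite -Cj; exact: (Cw j)].
  move=> [Aw Bw] k _; rewrite /= /C; case: ifP => [/eqP->//|_].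
  by case: ifP => [/eqP->|].
move=> ->; rewrite (bigD1 i)//= (bigD1 j) 1?eq_sym//= Ci Cj.
rewrite big1 ?mule1// => k /andP[ki kj].
by rewrite /C (negbTE ki) (negbTE kj) preimage_setT probability_setT.
Qed.

(** The second moment of the standard normal law, kept as an integral against the
    density, so that it is visibly the same number for all coordinates. *)
Definition normal_second_moment : R :=
  fine (\int[@lebesgue_measure R]_x ((x ^+ 2)%:E * (normal_pdf 0 1 x)%:E))%E.

Lemma noise_sqr i :
  (\int[P]_w (eps i w ^+ 2)%:E = normal_second_moment%:E)%E.
Proof.
have fin := integrable_fin_num measurableT (gaussian_sqr_integrable (eps_normal i)).
rewrite /normal_second_moment.
rewrite -(ge0_integral_gaussian (eps_normal i) (f := fun x => (x ^+ 2)%:E)).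
- by rewrite fineK.
- by apply/measurable_EFinP; exact: measurable_funX.
- by move=> x; rewrite lee_fin sqr_ge0.
Qed.

Lemma noise_mul_integrable i j :
  P.-integrable setT (fun w => (eps i w * eps j w)%:E).
Proof.
have [<-|ij] := eqVneq i j.
  by under eq_fun do rewrite -expr2; exact: gaussian_sqr_integrable (eps_normal i).
by apply: (integrable_indep_mul (X := eps i) (Y := eps j) (f := idfun) (g := idfun));
  [move=> A B; exact: mutually_independent_pair|exact: measurable_id|
   exact: measurable_id|exact: gaussian_integrable (eps_normal i)|
   exact: gaussian_integrable (eps_normal j)].
Qed.

Lemma noise_mul_mean i j : i != j ->
  (\int[P]_w (eps i w * eps j w)%:E = 0)%E.
Proof.
move=> ij.
rewrite (integral_indep_mul (X := eps i) (Y := eps j) (f := idfun) (g := idfun)).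
- by rewrite /= (gaussian_mean0 (eps_normal i)) mul0e.
- by move=> A B; exact: mutually_independent_pair.
- exact: measurable_id.
- exact: measurable_id.
- exact: gaussian_integrable (eps_normal i).
- exact: gaussian_integrable (eps_normal j).
Qed.

(** [G] stands for the events generated by the design and the sketch, and [N]
    for a random matrix that is a function of them. *)
Variables (G : set (set Omega)) (N : Omega -> 'M[R]_n).
Hypothesis indep_G :
  independent_sigma P (g_sigma_preimage (fun i => eps i : Omega -> R)) G.
Hypothesis mN : forall i j, measurable_fun setT (fun w => N w i j).
Hypothesis N_G : forall i j B, measurable B -> G ((fun w => N w i j) @^-1` B).
Hypothesis N_le1 : forall w i j, `|N w i j| <= 1.

Let entry i j : {RV P >-> R} :=
  HB.pack (fun w => N w i j) (isMeasurableFun.Build _ _ _ _ _ (mN i j)).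

Let noise_mul_meas i j : measurable_fun setT (fun w => eps i w * eps j w).
Proof. by apply: measurable_funM; exact: measurable_funPT. Qed.

Let noise_mul i j : {RV P >-> R} :=
  HB.pack (fun w => eps i w * eps j w)
    (isMeasurableFun.Build _ _ _ _ _ (noise_mul_meas i j)).

Lemma noise_mul_sigma i j B : measurable B ->
  g_sigma_preimage (fun i => eps i : Omega -> R) (noise_mul i j @^-1` B).
Proof.
move=> mB; pose Ob := g_sigma_algebraType (\big[setU/set0]_(i < n)
  preimage_set_system setT (eps i : Omega -> R) measurable).
have me k : measurable_fun (setT : set Ob) (eps k).
  exact: (@g_sigma_preimage_measurable_fun _ _ _ _ (fun i => eps i : Omega -> R)).
have := measurable_funM (me i) (me j); move=> /(_ measurableT B mB).
by rewrite setTI.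
Qed.

Let entry_noise_indep i j A B : measurable A -> measurable B ->
  P (entry i j @^-1` A `&` noise_mul i j @^-1` B) =
  (P (entry i j @^-1` A) * P (noise_mul i j @^-1` B))%E.
Proof.
move=> mA mB; rewrite setIC muleC; apply: indep_G; last exact: N_G.
exact: noise_mul_sigma.
Qed.

Let entry_integrable i j : P.-integrable setT (EFin \o entry i j).
Proof.
have ic := finite_measure_integrable_cst P (1 : R) measurableT.
apply: le_integrable ic => //.
- by apply/measurable_EFinP; exact: mN.
- by move=> w _ /=; rewrite lee_fin normr1 N_le1.
Qed.

Let term_integrable i j :
  P.-integrable setT (fun w => (N w i j * (eps i w * eps j w))%:E).
Proof.
apply: (integrable_indep_mul (X := entry i j) (Y := noise_mul i j)
  (f := idfun) (g := idfun)).
- exact: entry_noise_indep.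
- exact: measurable_id.
- exact: measurable_id.
- exact: entry_integrable.
- exact: noise_mul_integrable.
Qed.

Let term_integral i j :
  (\int[P]_w (N w i j * (eps i w * eps j w))%:E =
   if i == j then (\int[P]_w (N w i j)%:E) * normal_second_moment%:E else 0)%E.
Proof.
rewrite (integral_indep_mul (X := entry i j) (Y := noise_mul i j)
  (f := idfun) (g := idfun)).
- case: eqVneq => [<-|ij] /=; last by rewrite noise_mul_mean// mule0.
  by rewrite -(noise_sqr i).
- exact: entry_noise_indep.
- exact: measurable_id.
- exact: measurable_id.
- exact: entry_integrable.
- exact: noise_mul_integrable.
Qed.

Definition noise_vector w : 'cV[R]_n := \col_i eps i w.

Let quadratic_formE w : dot (noise_vector w) (N w *m noise_vector w) =
  \sum_i \sum_j N w i j * (eps i w * eps j w).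
Proof.
apply: eq_bigr => i _; rewrite !mxE mulr_sumr; apply: eq_bigr => j _.
by rewrite !mxE; ring.
Qed.

Lemma measurable_quadratic_form :
  measurable_fun setT (fun w => dot (noise_vector w) (N w *m noise_vector w)).
Proof.
under eq_fun do rewrite quadratic_formE.
apply: measurable_sum => i; apply: measurable_sum => j.
by apply: measurable_funM.
Qed.

(** The matrix is independent of the noise, whose coordinates are centred and
    pairwise independent: only the diagonal terms survive. *)
Lemma integral_quadratic_form :
  (\int[P]_w (dot (noise_vector w) (N w *m noise_vector w))%:E =
   normal_second_moment%:E * \int[P]_w (\tr (N w))%:E)%E.
Proof.
under eq_integral do rewrite quadratic_formE -sumEFin.
rewrite integral_sum//; last first.
  move=> i; under eq_fun do rewrite -sumEFin.
  by apply: integrable_sum => // j _.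
under eq_bigr => i _.
  under eq_integral do rewrite -sumEFin.
  rewrite integral_sum//.
  under eq_bigr do rewrite term_integral.
  rewrite -big_mkcond /= (big_pred1 i); last by move=> j; rewrite eq_sym.
  rewrite muleC.
over.
rewrite /mxtrace; under [in RHS]eq_integral do rewrite -sumEFin.
rewrite integral_sum//; last by move=> i; exact: entry_integrable.
rewrite fin_num_sume_distrr// => i j _ _.
apply: fin_num_adde_defl.
exact: (integrable_fin_num measurableT (entry_integrable j j)).
Qed.

End quadratic_form.

(** * Tail bounds *)

Section tail_bounds.
Context d (Omega : measurableType d) (R : realType) (P : probability Omega R).

Lemma markov_ge0 (f : Omega -> R) (a m : R) : 0 < a ->
  measurable_fun setT f -> (forall w, 0 <= f w) ->
  (\int[P]_w (f w)%:E <= m%:E)%E ->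
  (P [set w | (a < f w)%R] <= (m / a)%:E)%E.
Proof.
move=> a0 mf f0 fm; set S := [set w | _].
have mS : measurable S.
  by rewrite -[X in measurable X]setTI; exact: measurable_fun_ltr.
have : (a%:E * P S <= m%:E)%E.
  apply: le_trans fm; rewrite -integral_cst//.
  apply: (@le_trans _ _ (\int[P]_(w in S) (f w)%:E)%E).
    apply: ge0_le_integral => //.
    - by move=> w _; rewrite lee_fin ltW.
    - by apply/measurable_EFinP; exact: measurable_funTS.
    - by move=> w /= /ltW; rewrite lee_fin.
  apply: ge0_subset_integral => //; first exact/measurable_EFinP.
  by move=> w _; rewrite lee_fin.
have PS : P S \is a fin_num by exact: fin_num_measure.
by rewrite -(fineK PS) -EFinM !lee_fin ler_pdivlMr// mulrC.
Qed.

(** On the event [A] that the conditional probability of [E] is at least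
    [1 - del], averaging gives [P (E `&` A) >= (1 - del) P A], and [P A] is
    itself at least [1 - del]. *)
Lemma ab_type_probability (G : set (set Omega)) (a b : \bar R) E (del : R) :
  ab_type P G a b E -> 0 <= del <= 1 ->
  (expeR (- a) <= del%:E)%E -> (expeR (- b) <= del%:E)%E ->
  (P (~` E) <= (2 * del)%:E)%E.
Proof.
move=> [mE [g [[gG gi gE] Pg]]] /andP[d0 d1] ad bd.
pose A := [set w | 1 - del <= g w].
have AE : A = g @^-1` `[1 - del, +oo[%classic.
  by apply/seteqP; split => w /=; rewrite in_itv/= andbT.
have GA : G A by rewrite AE; apply: gG.
have mg : measurable_fun setT g by apply/measurable_EFinP; exact: measurable_int gi.
have mA : measurable A.
  by rewrite -[A]setTI; exact: (measurable_fun_ler (measurable_cst (1 - del)) mg).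
have [r [ar r0]] : exists r : R, expeR (- a) = r%:E /\ r <= del.
  have := expeR_ge0 (- a)%E; move: ad; case: (expeR _) => // r rd _.
  by exists r; split => //; rewrite -lee_fin.
have PA : ((1 - del)%:E <= P A)%E.
  apply: (@le_trans _ _ (1 - expeR (- b))%E); first by rewrite EFinB leeB.
  apply: le_trans Pg _; apply: le_measure; rewrite ?inE//.
    rewrite ar -[X in measurable X]setTI.
    under eq_set do rewrite -EFinB lee_fin.
    exact: (measurable_fun_ler (measurable_cst (1 - r)) mg).
  move=> w /=; rewrite ar -EFinB lee_fin; apply: le_trans.
  by rewrite lerB.
have PE : ((1 - del)%:E * (1 - del)%:E <= P E)%E.
  apply: (@le_trans _ _ ((1 - del)%:E * P A)%E).
    by rewrite lee_wpmul2l// lee_fin subr_ge0.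
  apply: (@le_trans _ _ (P (E `&` A))); last first.
    by apply: le_measure; rewrite ?inE//; exact: measurableI.
  rewrite -(gE _ GA) -integral_cst//; apply: ge0_le_integral => //.
  - by move=> w _; rewrite lee_fin subr_ge0.
  - by apply/measurable_EFinP; exact: measurable_funTS.
rewrite probability_setC//.
have PEf : P E \is a fin_num by exact: fin_num_measure.
move: PE; rewrite -(fineK PEf) -EFinM -EFinB !lee_fin.
have := sqr_ge0 del; lra.
Qed.

Lemma expeR_small (c : \bar R) (del : R) : (0 < c)%E -> 0 < del ->
  exists N : nat, forall n, (N <= n)%N ->
    (expeR (- (c * n%:R%:E)) <= del%:E)%E.
Proof.
move=> c0 d0.
have [r [r0 rc]] : exists r : R, 0 < r /\ (r%:E <= c)%E.
  by case: c c0 => [r r0|_|//]; [exists r|exists 1; rewrite leey].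
exists (Num.truncn (- ln del / r)).+1 => n Nn.
apply: (@le_trans _ _ (expeR (- (r%:E * n%:R%:E)))).
  by rewrite lee_expeR leeN2 lee_wpmul2r.
rewrite -EFinM -EFinN /= lee_fin -[leRHS]lnK// ler_expR lerNl.
rewrite -ler_pdivrMl// mulrC; apply: ltW.
apply: (@lt_le_trans _ _ (Num.truncn (- ln del / r)).+1%:R).
  exact: truncnS_gt.
by rewrite ler_nat.
Qed.

End tail_bounds.

(** * Error of the sketched estimator at the design points *)

Section empirical_error.
Context {R : realType} {T : Type} {H : set (T -> R)}.
Context {ip : (T -> R) -> (T -> R) -> R} {K : T -> T -> R}.
Hypothesis rkhs : is_rkhs H ip K.
Variables (n s : nat) (x : 'I_n -> T) (lam c : R) (S : 'M[R]_(s, n)).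
Variables (f0 : T -> R) (e : 'I_n -> R).
Hypotheses (n_gt0 : (0 < n)%N) (lam_gt0 : 0 < lam).
Hypothesis Hf0 : H f0.

Let Km := kernel_mx K x.
Let noise : 'cV[R]_n := \col_i e i.

Lemma f_hat_design y j : f_hat K x lam S y (x j) =
  (Km *m sketched_coef Km lam S y) j 0.
Proof.
rewrite /f_hat /beta_hat /sketched_coef mxE; apply: eq_bigr => i _.
by rewrite -scalemxAr !mxE; ring.
Qed.

Lemma sketched_coefD y z : sketched_coef Km lam S (y + z) =
  sketched_coef Km lam S y + sketched_coef Km lam S z.
Proof. by rewrite /sketched_coef !mulmxDr. Qed.

(** The fit is linear in the response, so the error splits into the error of the
    noiseless fit, bounded by [bias_satisfiable] with [F = n |f0|^2], and the fit
    of the noise, bounded by [sketched_variance]. *)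
Lemma empirical_error_le : K_satisfiable c lam Km S ->
  emp_norm_sq x (f_hat K x lam S (response f0 x e) \- f0) <=
  2 * (3 + 6 * c ^+ 2) * ip f0 f0 * lam +
  2 * (n%:R^-1 * dot noise (ridge_smoother Km lam *m noise)).
Proof.
move=> sat; pose z : 'cV[R]_n := \col_i f0 (x i).
have n0 : 0 < n%:R :> R by rewrite ltr0n.
have psdK : psdmx Km by exact: (kernel_mx_psd rkhs).
set bz := sketched_coef Km lam S z; set be := sketched_coef Km lam S noise.
have -> : emp_norm_sq x (f_hat K x lam S (response f0 x e) \- f0) =
    n%:R^-1 * dot (- (z - Km *m bz) + Km *m be) (- (z - Km *m bz) + Km *m be).
  congr (_ * _); apply: eq_bigr => j _; rewrite -expr2; congr (_ ^+ 2).
  rewrite /= f_hat_design.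
  have -> : response f0 x e = z + noise by apply/colP => i; rewrite !mxE.
  by rewrite sketched_coefD mulmxDr -/bz -/be !mxE; ring.
rewrite ler_pdivrMl//; apply: le_trans (dot_add_sqr_le _ _) _.
rewrite dotNl dotNr opprK.
have := bias_satisfiable psdK lam_gt0
  (mulr_ge0 (ler0n R n) (rkhs_ip_ge0 rkhs Hf0))
  (fun a => kernel_mx_dual rkhs x n_gt0 a Hf0) sat.
have := sketched_variance psdK lam_gt0 S noise; rewrite -/be -/bz.
set Q := dot noise _; rewrite mulrDr.
have -> : n%:R * (2 * (n%:R^-1 * Q)) = 2 * Q by field; rewrite gt_eqF.
move: (dot _ _) (dot (_ - _) _) => V B; lra.
Qed.

End empirical_error.

Section design_measurability.
Context {R : realType} dT (T : measurableType dT).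
Variables (K : T -> T -> R) (mu : nat -> R) (phi : nat -> T -> R).
Hypothesis mphi : forall i, measurable_fun setT (phi i).
Hypothesis mercer : forall x x',
  (\sum_(i < N) mu i * phi i x * phi i x') @[N --> \oo] --> K x x'.

Lemma measurable_kernel_mx d (Omega : measurableType d) n
    (x : 'I_n -> Omega -> T) : (forall i, measurable_fun setT (x i)) ->
  forall i j, measurable_fun setT (fun w => kernel_mx K (x^~ w) i j).
Proof.
move=> mx i j; under eq_fun do rewrite mxE; apply: measurable_funM => //.
apply: (measurable_fun_cvg
  (h := fun N w => \sum_(k < N) mu k * phi k (x i w) * phi k (x j w))).
  move=> N; apply: measurable_sum => k.
  by apply: measurable_funM; [apply: measurable_funM => //|];
    apply: measurableT_comp => //; exact: mphi.
by move=> w _; exact: mercer.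
Qed.

(** Measurability for the sigma-algebra generated by the design: the entries are
    measurable functions on any space on which the design points are. *)
Lemma ridge_smoother_sigma (Omega : pointedType) n (x : 'I_n -> Omega -> T) lam :
  (forall y : 'I_n -> T, psdmx (kernel_mx K y)) -> 0 < lam ->
  forall i j B, measurable B -> g_sigma_preimage x
    ((fun w => ridge_smoother (kernel_mx K (x^~ w)) lam i j) @^-1` B).
Proof.
move=> psdK lam0 i j B mB; pose Ob := g_sigma_algebraType (\big[setU/set0]_(i < n)
  preimage_set_system setT (x i) measurable).
have mx k : measurable_fun (setT : set Ob) (x k).
  exact: g_sigma_preimage_measurable_fun.
have := @measurable_ridge_smoother _ Ob R n _ lam (measurable_kernel_mx mx)
  (fun w => psdK _) lam0 i j.
by move=> /(_ measurableT B mB); rewrite setTI.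
Qed.

End design_measurability.

(** * Asymptotics of the exponentially decaying spectrum *)

Section asymptotics.
Context {R : realType}.

Lemma Theta_bounds (f g : nat -> R) :
  (f : nat -> R^o) =Theta_\oo (g : nat -> R^o) ->
  exists k1 k2 : R, [/\ 0 < k1, 0 < k2 & exists N, forall n, (N <= n)%N ->
    k1 * `|g n| <= `|f n| /\ `|f n| <= k2 * `|g n|].
Proof.
rewrite eqThetaE qualifE => /asboolP[[k1 k2] /= /andP[k10 k20] [N _ fg]].
by exists k1, k2; split=> //; exists N => n Nn; exact: fg.
Qed.

Lemma ln_nat_ge (c : R) : exists N, forall n, (N <= n)%N -> c <= ln n%:R.
Proof.
exists (Num.truncn (expR c)).+1 => n Nn.
have cn : expR c < n%:R.
  by apply: lt_le_trans (truncnS_gt _) _; rewrite ler_nat.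
by rewrite -ler_expR lnK ?(ltW cn)// posrE (lt_trans _ cn)// expR_gt0.
Qed.

Variable p : R.
Hypothesis p_ge1 : 1 <= p.

Let p_gt0 : 0 < p. Proof. exact: lt_le_trans p_ge1. Qed.

Local Notation L n := (ln n%:R `^ p^-1).

Lemma log_power_ge1 n : 1 <= ln n%:R :> R -> 1 <= L n :> R.
Proof.
by move=> l1; rewrite -[leLHS](powRr0 (ln n%:R)) ler_powR ?invr_ge0 ?(ltW p_gt0).
Qed.

Lemma lambda_dagger_le n : 1 <= ln n%:R :> R ->
  lambda_dagger p n <= 2 / ln n%:R :> R.
Proof.
move=> l1; have l0 : 0 < ln n%:R :> R by exact: lt_le_trans l1.
have n0 : 0 < n%:R :> R by rewrite ltNge; apply/negP => /ln0 l00; rewrite l00 ltxx in l0.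
(* [1 / p <= 1], and [(ln n)^2 <= 2 n] by the second order expansion of [expR]. *)
have Ln : L n <= ln n%:R :> R.
  by rewrite ler1_powR// invf_le1.
have : (ln n%:R) ^+ 2 <= 2 * n%:R :> R.
  have := expR_ge1Dxn 1 (ltW l0); rewrite lnK ?posrE//.
  rewrite (_ : 2`! = 2)%N//; lra.
rewrite expr2 => H; rewrite /lambda_dagger ler_pdivrMr// mulrAC ler_pdivlMr//.
by apply: le_trans H; rewrite ler_wpM2r// ltW.
Qed.

Section spectrum.
Variables (gamma : R) (mu : nat -> R).
Hypotheses (gamma_gt0 : 0 < gamma) (mu_ge0 : forall i, 0 <= mu i).
Hypothesis mu_decr : forall i j, (i <= j)%N -> mu j <= mu i.
Hypothesis mu_decay : (mu : nat -> R^o) =Theta_\oo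
  (fun i => expR (- gamma * i.+1%:R `^ p) : R^o).

Lemma eigenvalue_gt0 i : 0 < mu i.
Proof.
have [k1 [k2 [k10 k20 [N mub]]]] := Theta_bounds mu_decay.
apply: lt_le_trans (mu_decr (leq_maxl i N)).
have [+ _] := mub _ (leq_maxr i N); rewrite (ger0_norm (mu_ge0 _)).
by apply: lt_le_trans; rewrite mulr_gt0// normr_gt0 gt_eqF// expR_gt0.
Qed.

Lemma eigenvalue_small (del : R) : 0 < del -> exists i, mu i <= del.
Proof.
move=> d0; have [k1 [k2 [k10 k20 [N mub]]]] := Theta_bounds mu_decay.
pose i := maxn N (Num.truncn (k2 / (gamma * del))).
exists i; have [_] := mub i (leq_maxl _ _).
rewrite (ger0_norm (mu_ge0 _)) ger0_norm ?expR_ge0// => /le_trans; apply.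
have i1 : k2 / (gamma * del) < i.+1%:R.
  by apply: lt_le_trans (truncnS_gt _) _; rewrite ler_nat ltnS leq_maxr.
have ip : i.+1%:R <= i.+1%:R `^ p :> R.
  by rewrite le1r_powR// ler1n.
rewrite mulNr expRN ler_pdivrMr ?expR_gt0//.
have E := expR_ge1Dx (gamma * i.+1%:R `^ p).
have gi : gamma * i.+1%:R <= gamma * i.+1%:R `^ p by rewrite ler_wpM2l// ltW.
have k2i : k2 <= del * (gamma * i.+1%:R).
  by move: (ltW i1); rewrite ler_pdivrMr ?mulr_gt0//; lra.
apply: le_trans k2i _; rewrite ler_wpM2l ?(ltW d0)//; lra.
Qed.

(** Eigenvalues tend to zero, so the set that defines [s_pop] is nonempty, and
    its least element cannot be reached before [mu] falls below [mu M]. *)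
Lemma s_pop_gt M (lam : R) : 0 < lam -> lam < mu M -> (M < s_pop mu lam)%N.
Proof.
move=> lam0 lamM.
have ex : exists k, mu k <= lam by exact: eigenvalue_small.
have : [set k | mu k <= lam /\ forall j, (j < k)%N -> lam < mu j] (s_pop mu lam).
  apply: xgetPex; exists (ex_minn ex); case: ex_minnP => k mk kmin; split => // j jk.
  by rewrite ltNge; apply/negP => /kmin; rewrite leqNgt jk.
move=> [muk _]; rewrite ltnNge; apply/negP => /mu_decr Mk.
by have := le_lt_trans (le_trans Mk muk) lamM; rewrite ltxx.
Qed.

Variable Ct : R.
Hypothesis A1_tail : forall k,
  (\sum_(k.+1 <= i <oo) (mu i)%:E <= (Ct * (k.+1%:R * mu k))%:E)%E.

Lemma tail_sum_le k N :
  \sum_(k.+1 <= i < N) mu i <= Ct * (k.+1%:R * mu k).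
Proof.
rewrite -lee_fin -sumEFin; apply: le_trans (A1_tail k).
by apply: nneseries_lim_ge => i _ _; rewrite lee_fin.
Qed.

(** The cutoff [k] is the first integer above [r = (ln n / gamma) ^ (1 / p)],
    where the exponential decay reaches [1 / n]; by the tail condition the
    eigenvalues beyond [k] add up to at most a multiple of [k / n]. *)
Lemma spectral_cutoff : exists B0 B1 : R, [/\ 0 <= B0, 0 <= B1 &
  exists N0, forall n, (N0 <= n)%N -> exists k,
    k%:R <= B0 * L n /\
    forall N, (k <= N)%N -> \sum_(k <= i < N) mu i <= B1 * L n / n%:R].
Proof.
have [k1 [k2 [k10 k20 [Nmu mub]]]] := Theta_bounds mu_decay.
have [N1 ln1] := ln_nat_ge 1.
have [N2 ln2] := ln_nat_ge (gamma * Nmu%:R `^ p).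
pose g := gamma^-1 `^ p^-1; have g0 : 0 <= g by exact: powR_ge0.
exists (g + 1), (`|Ct| * k2 * (g + 1)); split.
- by rewrite addr_ge0.
- by rewrite !mulr_ge0 ?addr_ge0// ltW.
exists (maxn N1 N2) => n; rewrite geq_max => /andP[Nn1 Nn2].
have l1 := ln1 _ Nn1; have l0 : 0 < ln n%:R :> R by exact: lt_le_trans l1.
have n0 : 0 < n%:R :> R by rewrite ltNge; apply/negP => /ln0 l00; rewrite l00 ltxx in l0.
have L1 := log_power_ge1 l1.
pose r := (gamma^-1 * ln n%:R) `^ p^-1; have r0 : 0 <= r by exact: powR_ge0.
have gi0 : 0 <= gamma^-1 by rewrite invr_ge0 ltW.
have rE : r = g * L n by rewrite /r powRM// ltW.
have rp : r `^ p = gamma^-1 * ln n%:R.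
  by rewrite /r -powRrM mulVf ?gt_eqF// powRr1// mulr_ge0// ltW.
pose j := Num.truncn r; have jr : j%:R <= r by rewrite truncn_le.
have rj : r < j.+1%:R by exact: truncnS_gt.
have kB : j.+1%:R <= (g + 1) * L n by rewrite -natr1; move: L1 jr; rewrite rE; lra.
have Nj : (Nmu <= j)%N.
  have Nr : Nmu%:R <= r.
    rewrite leNgt; apply/negP => rN.
    have := gt0_ltr_powR p_gt0; move=> /(_ r Nmu%:R); rewrite !nnegrE => /(_ r0 (ler0n _ _) rN).
    rewrite rp mulrC ltr_pdivrMr// mulrC => /lt_le_trans /(_ (ln2 _ Nn2)).
    by rewrite ltxx.
  by rewrite -ltnS -(ltr_nat R) (le_lt_trans Nr).
have muj : mu j <= k2 / n%:R.
  have [_] := mub j Nj; rewrite (ger0_norm (mu_ge0 _)) ger0_norm ?expR_ge0//.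
  move=> /le_trans; apply; rewrite ler_wpM2l ?(ltW k20)//.
  rewrite mulNr expRN lef_pV2 ?posrE ?expR_gt0// -[leLHS]lnK ?posrE// ler_expR.
  rewrite -ler_pdivrMl// -rp; apply: ge0_ler_powR; rewrite ?nnegrE ?ler0n ?(ltW p_gt0)//.
  exact: ltW.
exists j.+1; split => // N _; apply: le_trans (tail_sum_le j N) _.
apply: (@le_trans _ _ (`|Ct| * ((g + 1) * L n * (k2 / n%:R)))); last first.
  by rewrite le_eqVlt; apply/orP; left; apply/eqP; field; rewrite gt_eqF.
apply: le_trans (ler_wpM2r _ (ler_norm Ct)) _; first by rewrite mulr_ge0.
by rewrite ler_wpM2l// ler_pM.
Qed.

End spectrum.
End asymptotics.

(** * Rate of convergence *)

Section exponential_decay.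
Context {R : realType} {T : Type} {H : set (T -> R)}.
Context {ip : (T -> R) -> (T -> R) -> R} {K : T -> T -> R}.
Hypothesis rkhs : is_rkhs H ip K.
Variables (mu : nat -> R) (phi : nat -> T -> R) (C Ct gamma p : R).
Hypothesis mu_ge0 : forall i, 0 <= mu i.
Hypothesis phi_H : forall i, H (phi i).
Hypothesis phi_ip : forall i, ip (phi i) (phi i) = (mu i)^-1.
Hypothesis phi_bound : forall i t, `|phi i t| <= C.
Hypothesis mercer : forall x x',
  (\sum_(i < N) mu i * phi i x * phi i x') @[N --> \oo] --> K x x'.
Hypothesis A1_tail : forall k,
  (\sum_(k.+1 <= i <oo) (mu i)%:E <= (Ct * (k.+1%:R * mu k))%:E)%E.
Hypotheses (gamma_gt0 : 0 < gamma) (p_ge1 : 1 <= p).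
Hypothesis mu_decay : (mu : nat -> R^o) =Theta_\oo
  (fun i => expR (- gamma * i.+1%:R `^ p) : R^o).

(** For [lam] of order [(ln n)^(1/p) / n], the cutoff of [spectral_cutoff] makes
    the first term of [trace_ridge_le] a multiple of [(ln n)^(1/p)] and the
    second one bounded. *)
Lemma trace_ridge_log (m1 : R) : 0 < m1 -> exists B : R, 0 <= B /\
  exists N0, forall n, (N0 <= n)%N -> forall lam, 0 < lam ->
    m1 * lambda_dagger p n <= lam -> forall x : 'I_n -> T,
    \tr (ridge_smoother (kernel_mx K x) lam) <= B * ln n%:R `^ p^-1.
Proof.
move=> m10; have [B0 [B1 [B00 B10 [N0 cut]]]] :=
  spectral_cutoff p_ge1 gamma_gt0 mu_ge0 mu_decay A1_tail.
have [N1 ln1] := ln_nat_ge (1 : R).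
exists (B0 + C ^+ 2 * B1 / m1); split.
  by rewrite addr_ge0// divr_ge0 ?(ltW m10)// mulr_ge0 ?sqr_ge0.
exists (maxn N0 N1) => n; rewrite geq_max => /andP[Nn0 Nn1] lam lam0 lamn x.
have l1 := ln1 _ Nn1; have L1 := log_power_ge1 p_ge1 l1.
have n_gt0 : (0 < n)%N.
  by case: n l1 {Nn0 Nn1 lamn x L1} => //; rewrite ln0// ler10.
have [k [kL tail]] := cut _ Nn0.
have := trace_ridge_le rkhs mu_ge0 phi_H phi_ip phi_bound mercer x n_gt0 lam0 tail.
move=> /le_trans; apply; rewrite mulrDl lerD//.
have n0 : 0 < n%:R :> R by rewrite ltr0n.
rewrite mulrAC ler_pdivrMr//.
apply: (@le_trans _ _ (C ^+ 2 * B1 / m1 * (m1 * lambda_dagger p n))).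
  rewrite /lambda_dagger le_eqVlt; apply/orP; left; apply/eqP.
  by field; rewrite !gt_eqF.
have c0 : 0 <= C ^+ 2 * B1 / m1.
  by rewrite divr_ge0 ?(ltW m10)// mulr_ge0 ?sqr_ge0.
rewrite -[leRHS]mulrA ler_wpM2l//; apply: le_trans lamn _.
by rewrite ler_peMl// ltW.
Qed.

End exponential_decay.

Theorem corollary4p11 (R : realType) (d : nat) (d_gt0 : (0 < d)%N)
    (X : set (d.-tuple R)) (x0 : X) (PX : probability (covariate x0) R)
    (H : set (covariate x0 -> R))
    (ip : (covariate x0 -> R) -> (covariate x0 -> R) -> R)
    (K : covariate x0 -> covariate x0 -> R)
    (mu : nat -> R) (phi : nat -> covariate x0 -> R)
    (f0 : covariate x0 -> R) (gamma p : R)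
    (H_rkhs : is_rkhs H ip K)
    (H_L2 : forall f, H f -> f \in Lfun PX 2%:E)
    (H_eigen : is_eigensystem PX H ip K mu phi)
    (A1 : assumption_A1 mu phi)
    (H_f0 : H f0)
    (gamma_gt0 : 0 < gamma) (p_ge1 : 1 <= p)
    (mu_decay : (mu : nat -> R^o) =Theta_\oo
       (fun i => expR (- gamma * i.+1%:R `^ p) : R^o)) :
  exists D0 : R, 0 < D0 /\
  forall (D c : R) (c1 c2 : \bar R), D0 <= D -> 0 < c -> (0 < c1)%E ->
    (0 < c2)%E ->
  forall (dO : measure_display) (Omega : measurableType dO)
    (P : probability Omega R)
    (x : forall n, 'I_n -> {RV P >-> covariate x0})
    (eps : forall n, 'I_n -> {RV P >-> R})
    (s : nat -> nat) (S : forall n, Omega -> 'M[R]_(s n, n))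
    (lam : nat -> R),
    sketched_model PX x eps S ->
    (forall n, 0 < lam n) ->
    (lam : nat -> R^o) =Theta_\oo (lambda_dagger p : nat -> R^o) ->
    assumption_A2 K mu x S lam D c c1 c2 ->
    bigO_P P
      (fun n w =>
         let xw := fun i : 'I_n => x n i w in
         let y := response f0 xw (fun i => eps n i w) in
         emp_norm_sq xw (f_hat K xw (lam n) (S n w) y \- f0))
      (fun n => n%:R^-1 * ln n%:R `^ p^-1).
Proof.
case: H_eigen => mu_ge0 mu_decr phi_L2 _ _ phi_H phi_ip mercer.
case: A1 => -[C phi_bound] [Ct A1_tail].
have phi_ip' i : ip (phi i) (phi i) = (mu i)^-1 by rewrite phi_ip eqxx mul1r.
have mphi i : measurable_fun setT (phi i).
  by have /andP[+ _] := phi_L2 i; rewrite inE.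
(* For every [D > 0], [D * s_pop <= s] forces [s n] to infinity with [s_pop]. *)
exists 1; split=> // D c c1 c2 D1 c0 c10 c20 dO Omega P x eps s S lam.
move=> model lam0 lam_theta [A2s A2e] e e0.
have [m1 [m2 [m10 m20 [Nl lamb]]]] := Theta_bounds lam_theta.
have [B [B0 [NB trB]]] := trace_ridge_log H_rkhs mu_ge0 phi_H phi_ip' phi_bound
  mercer A1_tail gamma_gt0 p_ge1 mu_decay m10.
pose v := normal_second_moment R.
have v0 : 0 <= v.
  apply: fine_ge0; apply: integral_ge0 => y _.
  by rewrite -EFinM lee_fin mulr_ge0 ?sqr_ge0 ?normal_pdf_ge0.
pose del := Num.min 1 (e / 4).
have del0 : 0 < del by rewrite lt_min ltr01 divr_gt0.
have del1 : del <= 1 by rewrite ge_min lexx.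
have dele : 2 * del <= e / 2.
  have : del <= e / 4 by rewrite ge_min lexx orbT.
  lra.
(* The noise term has mean at most [v * B * (ln n)^(1/p)], so by Markov it exceeds
   [a * (ln n)^(1/p)] with probability at most [v * B / a <= e / 2]. *)
pose a := 2 * (v * B) / e + 1.
have a0 : 0 < a by rewrite ltr_wpDl// divr_ge0 ?(ltW e0)// mulr_ge0// mulr_ge0.
pose F := ip f0 f0; have F0 : 0 <= F := rkhs_ip_ge0 H_rkhs H_f0.
pose b := 2 * (3 + 6 * c ^+ 2) * F.
have b0 : 0 <= b.
  by rewrite mulr_ge0// mulr_ge0// addr_ge0// mulr_ge0// sqr_ge0.
exists (b * m2 + 2 * a); split.
  by rewrite ltr_wpDl ?mulr_gt0// mulr_ge0// ltW.
have [M1 cs1] := expeR_small c10 del0; have [M2 cs2] := expeR_small c20 del0.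
pose M := maxn M1 M2.
(* Once [lam n < mu M], both exponents of the type of the event are large. *)
have muM := eigenvalue_gt0 mu_ge0 mu_decr mu_decay M.
have [N1 ln1] := ln_nat_ge (1 : R).
have [N2 ln2] := ln_nat_ge (2 * m2 / (mu M) + 1).
near=> n.
have Nn1 : (N1 <= n)%N by near: n; exact: nbhs_infty_ge.
have Nn2 : (N2 <= n)%N by near: n; exact: nbhs_infty_ge.
have NnB : (NB <= n)%N by near: n; exact: nbhs_infty_ge.
have Nnl : (Nl <= n)%N by near: n; exact: nbhs_infty_ge.
have sn : D * (s_pop mu (lam n))%:R <= (s n)%:R by near: n.
have En : ab_type P (g_sigma_preimage (fun i => x n i : Omega -> covariate x0))
       (c1 * (s n)%:R%:E)%E (c2 * (s_pop mu (lam n))%:R%:E)%E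
       [set w | K_satisfiable c (lam n)
                  (kernel_mx K (fun i => x n i w)) (S n w)] by near: n.
have l1 := ln1 _ Nn1; have L1 := log_power_ge1 p_ge1 l1.
set L := ln n%:R `^ p^-1 in L1 *.
have n_gt0 : (0 < n)%N.
  by case: (n) l1 => //; rewrite ln0// ler10.
have n0 : 0 < n%:R :> R by rewrite ltr0n.
have ld0 : 0 <= lambda_dagger p n :> R by rewrite divr_ge0// powR_ge0.
have [lam1 lam2] := lamb _ Nnl.
rewrite (ger0_norm ld0) (ger0_norm (ltW (lam0 n))) in lam1 lam2.
have lamM : lam n < mu M.
  apply: le_lt_trans lam2 _.
  apply: (@le_lt_trans _ _ (m2 * (2 / ln n%:R))).
    by rewrite ler_wpM2l ?(ltW m20)// (lambda_dagger_le p_ge1).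
  have := ln2 _ Nn2; have lnp : 0 < ln n%:R :> R by exact: lt_le_trans l1.
  rewrite mulrA ltr_pdivrMr// => H2.
  have : mu M * (2 * m2 / mu M + 1) <= mu M * ln n%:R by rewrite ler_wpM2l// ltW.
  by rewrite mulrDr mulrCA divff ?gt_eqF// mulr1; lra.
have sM := s_pop_gt p_ge1 gamma_gt0 mu_ge0 mu_decr mu_decay (lam0 n) lamM.
have sM1 : (M1 <= s n)%N.
  rewrite -(ler_nat R); apply: le_trans sn.
  apply: (@le_trans _ _ (1 * (s_pop mu (lam n))%:R)); last by rewrite ler_wpM2r.
  by rewrite mul1r ler_nat (leq_trans (leq_maxl M1 M2))// ltnW.
have sM2 : (M2 <= s_pop mu (lam n))%N by rewrite (leq_trans (leq_maxr M1 M2))// ltnW.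
have del01 : 0 <= del <= 1 by rewrite del1 ltW.
have PE := ab_type_probability En del01 (cs1 _ sM1) (cs2 _ sM2).
pose N w := ridge_smoother (kernel_mx K (fun i => x n i w)) (lam n).
have psdK (y : 'I_n -> covariate x0) : psdmx (kernel_mx K y).
  exact: (kernel_mx_psd H_rkhs).
have mN i j : measurable_fun setT (fun w => N w i j).
  apply: measurable_ridge_smoother => //.
  by apply: (measurable_kernel_mx mphi mercer) => k; exact: measurable_funPT.
have NG i j A : measurable A ->
    <<s g_sigma_preimage (fun i => x n i : Omega -> covariate x0) `|` sigma_mx (S n) >>
      ((fun w => N w i j) @^-1` A).
  move=> mA; apply: sub_sigma_algebra; left.
  exact: (ridge_smoother_sigma mphi mercer
    (x := fun i => x n i : Omega -> covariate x0) psdK (lam0 n)).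
have N1le w i j : `|N w i j| <= 1 by exact: ridge_smoother_entry_le1.
have eps_law i A : measurable A ->
    distribution P (eps n i) A = normal_prob 0 1 A by exact: (model_eps_law model).
have eps_indep : mutually_independent P (fun i => eps n i : Omega -> R).
  exact: (model_eps_indep model).
have indep := model_indep model (n := n).
have EQ := integral_quadratic_form eps_law eps_indep indep mN NG N1le.
have mQ := measurable_quadratic_form (eps n) mN.
set Q := fun w => dot _ _ in mQ.
have Qle : (\int[P]_w (Q w)%:E <= (v * (B * L))%:E)%E.
  rewrite EQ -/v EFinM lee_wpmul2l ?lee_fin//.
  apply: (@le_trans _ _ (\int[P]_w (B * L)%:E)%E).
    apply: ge0_le_integral => //.
    - by move=> w _; rewrite lee_fin; exact: ridge_smoother_trace_ge0 (psdK _) (lam0 n).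
    - by apply/measurable_EFinP; apply: measurable_sum => i; exact: mN.
    - move=> w _; rewrite lee_fin; exact: trB.
  by rewrite integral_cst//= probability_setT mule1.
have Q0 w : 0 <= Q w by apply: ridge_smoother_ge0.
have aL : 0 < a * L by rewrite mulr_gt0// (lt_le_trans ltr01).
have PQ := markov_ge0 aL mQ Q0 Qle.
set E := [set w | K_satisfiable _ _ _ _] in En PE.
have mE : measurable E by case: En.
(* Off this event the sketch is satisfiable and the noise term is controlled. *)
exists (~` E `|` [set w | a * L < Q w]); split.
- apply: measurableU; first exact: measurableC.
  rewrite -[X in measurable X]setTI; exact: measurable_fun_ltr.
- move=> w /= big; have [Ew|] := pselect (E w); last by left.
  right; rewrite ltNge; apply/negP => QL; move: big; rewrite ltNge => /negP; apply.
  have err := empirical_error_le H_rkhs (fun i => eps n i w) n_gt0 (lam0 n) H_f0 Ew.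
  rewrite ger0_norm; last first.
    by rewrite mulr_ge0 ?invr_ge0 ?ler0n// sumr_ge0// => i _; exact: sqr_ge0.
  apply: le_trans err _; rewrite -/F -/b.
  have lamL : b * lam n <= b * (m2 * (L / n%:R)) by rewrite ler_wpM2l.
  have QLn : n%:R^-1 * Q w <= n%:R^-1 * (a * L).
    by rewrite ler_wpM2l ?invr_ge0 ?ler0n.
  rewrite -[dot _ _]/(Q w); move: lamL QLn; lra.
- apply: le_trans (measureU2 _ _ _) _ => //.
    exact: measurableC.
    by rewrite -[X in measurable X]setTI; exact: measurable_fun_ltr.
  apply: le_trans (leeD PE PQ) _; rewrite -EFinD lee_fin.
  have : v * (B * L) / (a * L) <= e / 2; last by move: dele; lra.
  rewrite ler_pdivrMr// mulrA mulrA ler_wpM2r ?(le_trans ler01)//.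
  have : e / 2 * a = v * B + e / 2 by rewrite /a; field; rewrite gt_eqF.
  by move=> ->; rewrite lerDl ltW// divr_gt0.
Unshelve. all: by end_near.
Qed.
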